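(* Let $(\mathcal{G},\Gamma)$ be a finite graph of groups, i.e. a graph of groups over a finite connected graph $\Gamma$, such that every vertex group $\mathcal{G}(v)$, $v\in V(\Gamma)$, is conjugacy separable and every edge group $\mathcal{G}(e)$, $e\in E(\Gamma)$, is finite. Then the fundamental group $\pi_1(\mathcal{G},\Gamma)$ is conjugacy separable.
   Context: A group $G$ is conjugacy separable if whenever $x$ and $y$ are non-conjugate elements of $G$, there is a finite homomorphic image of $G$ in which the images of $x$ and $y$ are non-conjugate. Graphs are oriented: a graph $\Gamma$ has a vertex set $V(\Gamma)$, an edge set $E(\Gamma)$, and maps $d_0,d_1$ sending each edge to its origin and terminal vertex respectively. The graph is finite if both $V(\Gamma)$ and $E(\Gamma)$ are finite. Loops and multiple edges are allowed. A graph of groups $(\mathcal{G},\Gamma)$ over a connected graph $\Gamma$ consists of a group $\mathcal{G}(v)$ for each vertex $v$, a group $\mathcal{G}(e)$ for each edge $e$, and injective homomorphisms $\partial_i:\mathcal{G}(e)\to\mathcal{G}(d_i(e))$ ($i=0,1$) for each edge $e$. Its fundamental group $\pi_1(\mathcal{G},\Gamma)$ is the usual (abstract) Bass–Serre fundamental group: choosing a maximal subtree $T$ of $\Gamma$, it is the group generated by all the vertex groups $\mathcal{G}(v)$ ($v\in V(\Gamma)$) together with elements $t_e$ ($e\in E(\Gamma)$), subject to the relations of the vertex groups, $t_e=1$ for $e\in E(T)$, and $\partial_0(x)=t_e\,\partial_1(x)\,t_e^{-1}$ for all $e\in E(\Gamma)$ and $x\in\mathcal{G}(e)$. Up to isomorphism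 it does not depend on the choice of $T$. *)

(* Defs.v *)
From HB Require Import structures.
From mathcomp Require Import all_boot all_fingroup.
From mathcomp Require Import generic_quotient.
From mathcomp Require Import boolp classical_sets cardinality.

Set Implicit Arguments.
Unset Strict Implicit.
Unset Printing Implicit Defensive.

Local Open Scope quotient_scope.
Local Open Scope classical_set_scope.
Local Open Scope group_scope.

(* Arbitrary (possibly infinite) groups are [groupType]s.  A [groupType]
   carries a [choiceType] structure, which is no restriction: by
   [boolp.gen_eqMixin] and [boolp.gen_choiceMixin] every type has one. *)

Definition conjugate_elts (G : groupType) (x y : G) : Prop := exists g : G, x ^ g = y.

Definition conjugacy_separable (G : groupType) : Prop :=
  forall x y : G, ~ conjugate_elts x y ->
    exists (Q : finGroupType) (f : {multiplicative G -> Q}),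
      (forall q : Q, exists g : G, f g = q) /\ ~ conjugate_elts (f x) (f y).

Section Presentation.
Variable X : choiceType.

(* The letter [(x, false)] stands for the generator [x], and [(x, true)] for
   its inverse. *)
Definition word := seq (X * bool).

Definition inv_letter (a : X * bool) : X * bool := (a.1, ~~ a.2).

Definition inv_word (w : word) : word := rev (map inv_letter w).

Variable R : word -> word -> Prop.

(* Equality of words in the group < X | u = v for all u, v with R u v >. *)
Inductive word_eq : word -> word -> Prop :=
| word_eq_rel u v : R u v -> word_eq u v
| word_eq_cancel a : word_eq [:: a; inv_letter a] [::]
| word_eq_refl u : word_eq u u
| word_eq_sym u v : word_eq u v -> word_eq v u
| word_eq_trans u v w : word_eq u v -> word_eq v w -> word_eq u w
| word_eq_cat u u' v v' :
    word_eq u u' -> word_eq v v' -> word_eq (u ++ v) (u' ++ v').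

Definition word_eqb (u v : word) : bool := `[< word_eq u v >].

Lemma word_eqb_refl : reflexive word_eqb.
Proof. by move=> u; apply/asboolP; apply: word_eq_refl. Qed.

Lemma word_eqb_sym : symmetric word_eqb.
Proof. by move=> u v; apply/asboolP/asboolP; apply: word_eq_sym. Qed.

Lemma word_eqb_trans : transitive word_eqb.
Proof.
move=> v u w /asboolP uv /asboolP vw; apply/asboolP.
exact: word_eq_trans uv vw.
Qed.

Canonical word_eqb_equiv :=
  EquivRel word_eqb word_eqb_refl word_eqb_sym word_eqb_trans.

Definition presented := {eq_quot word_eqb}.

HB.instance Definition _ := Choice.on presented.
HB.instance Definition _ := EqQuotient.on presented.

Lemma inv_letterK : involutive inv_letter.
Proof. by case=> x b; rewrite /inv_letter /= negbK. Qed.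

Lemma inv_wordK : involutive inv_word.
Proof.
move=> w; rewrite /inv_word map_rev revK -map_comp -[RHS]map_id.
by apply: eq_map => a /=; rewrite inv_letterK.
Qed.

Lemma inv_word_cat u v : inv_word (u ++ v) = inv_word v ++ inv_word u.
Proof. by rewrite /inv_word map_cat rev_cat. Qed.

Lemma word_eq_mulV w : word_eq (w ++ inv_word w) [::].
Proof.
elim: w => [|a w IHw]; first exact: word_eq_refl.
rewrite -cat1s inv_word_cat -catA (catA w).
apply: word_eq_trans (word_eq_cancel a).
rewrite -[X in word_eq _ X]cat1s.
apply: word_eq_cat; first exact: word_eq_refl.
rewrite -[X in word_eq _ X]cat0s.
by apply: word_eq_cat => //; apply: word_eq_refl.
Qed.

Lemma word_eq_Vmul w : word_eq (inv_word w ++ w) [::].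
Proof. by rewrite -[w in _ ++ w]inv_wordK; apply: word_eq_mulV. Qed.

Lemma word_eq_inv u v : word_eq u v -> word_eq (inv_word u) (inv_word v).
Proof.
move=> uv; rewrite -[inv_word u]cats0.
apply: (@word_eq_trans _ (inv_word u ++ (v ++ inv_word v))).
  apply: word_eq_cat; first exact: word_eq_refl.
  exact/word_eq_sym/word_eq_mulV.
rewrite catA -[X in word_eq _ X]cat0s.
apply: word_eq_cat; last exact: word_eq_refl.
apply: (word_eq_trans _ (word_eq_Vmul u)).
by apply: word_eq_cat; [apply: word_eq_refl | apply: word_eq_sym].
Qed.

Definition pclass (w : word) : presented := \pi_presented w.

Lemma pclassP u v : pclass u = pclass v <-> word_eq u v.
Proof.
split=> [/eqquotP/asboolP //|uv].
by apply/eqquotP/asboolP.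
Qed.

Lemma pclass_repr (c : presented) : pclass (repr c) = c.
Proof. exact: reprK. Qed.

Definition presented_one : presented := pclass [::].
Definition presented_mul (a b : presented) : presented :=
  pclass (repr a ++ repr b).
Definition presented_inv (a : presented) : presented :=
  pclass (inv_word (repr a)).

Lemma pclassM u v : presented_mul (pclass u) (pclass v) = pclass (u ++ v).
Proof. by apply/pclassP/word_eq_cat; apply/pclassP; rewrite pclass_repr. Qed.

Lemma pclassV u : presented_inv (pclass u) = pclass (inv_word u).
Proof. by apply/pclassP/word_eq_inv/pclassP; rewrite pclass_repr. Qed.

Lemma presented_mulA : associative presented_mul.
Proof.
move=> a b c; rewrite -[a]pclass_repr -[b]pclass_repr -[c]pclass_repr.
by rewrite !pclassM catA.
Qed.

Lemma presented_mul1 : left_id presented_one presented_mul.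
Proof. by move=> a; rewrite -[a]pclass_repr pclassM. Qed.

Lemma presented_1mul : right_id presented_one presented_mul.
Proof. by move=> a; rewrite -[a]pclass_repr pclassM cats0. Qed.

Lemma presented_mulV :
  left_inverse presented_one presented_inv presented_mul.
Proof.
move=> a; rewrite -[a]pclass_repr pclassV pclassM.
exact/pclassP/word_eq_Vmul.
Qed.

Lemma presented_Vmul :
  right_inverse presented_one presented_inv presented_mul.
Proof.
move=> a; rewrite -[a]pclass_repr pclassV pclassM.
exact/pclassP/word_eq_mulV.
Qed.

HB.instance Definition _ := isGroup.Build presented
  presented_mulA presented_mul1 presented_1mul presented_mulV presented_Vmul.

End Presentation.

Record graph := Graph {
  vertex : choiceType;
  edge : choiceType;
  d0 : edge -> vertex;
  d1 : edge -> vertex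
}.

Definition finite_graph (Gamma : graph) : Prop :=
  finite_set [set: vertex Gamma] /\ finite_set [set: edge Gamma].

Section Graphs.
Variable Gamma : graph.

(* Paths ignore the orientation: the step [(e, false)] traverses [e] from
   [d0 e] to [d1 e], and [(e, true)] traverses it from [d1 e] to [d0 e]. *)
Definition step := (edge Gamma * bool)%type.

Definition step_src (a : step) : vertex Gamma := if a.2 then d1 a.1 else d0 a.1.
Definition step_tgt (a : step) : vertex Gamma := if a.2 then d0 a.1 else d1 a.1.

Fixpoint walk (x : vertex Gamma) (p : seq step) (y : vertex Gamma) : bool :=
  if p is a :: p' then (step_src a == x) && walk (step_tgt a) p' y else x == y.

Record subgraph := Subgraph {
  sub_vertex : set (vertex Gamma);
  sub_edge : set (edge Gamma);
  sub_d0 : forall e, sub_edge e -> sub_vertex (d0 e);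
  sub_d1 : forall e, sub_edge e -> sub_vertex (d1 e)
}.

Definition full_subgraph : subgraph :=
  @Subgraph setT setT (fun _ _ => I) (fun _ _ => I).

Definition walk_in (S : subgraph) (p : seq step) : Prop :=
  forall a : step, a \in p -> sub_edge S a.1.

Definition connected_subgraph (S : subgraph) : Prop :=
  forall x y, sub_vertex S x -> sub_vertex S y ->
    exists p, walk x p y /\ walk_in S p.

Definition connected_graph : Prop := connected_subgraph full_subgraph.

(* A loop is a circuit of length 1, and two distinct edges with the same pair
   of endpoints form a circuit of length 2. *)
Definition circuit (p : seq step) : Prop :=
  [/\ p != [::], exists x, walk x p x, uniq (map step_tgt p)
    & uniq (map fst p)].

Definition subtree (S : subgraph) : Prop :=
  connected_subgraph S /\ forall p, walk_in S p -> ~ circuit p.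

Definition maximal_subtree (T : subgraph) : Prop :=
  subtree T /\
  forall S, subtree S ->
    sub_vertex T `<=` sub_vertex S -> sub_edge T `<=` sub_edge S ->
    sub_vertex S `<=` sub_vertex T /\ sub_edge S `<=` sub_edge T.

End Graphs.

Record graph_of_groups (Gamma : graph) := GraphOfGroups {
  vertex_group : vertex Gamma -> groupType;
  edge_group : edge Gamma -> groupType;
  bd0 : forall e, {multiplicative edge_group e -> vertex_group (d0 e)};
  bd1 : forall e, {multiplicative edge_group e -> vertex_group (d1 e)};
  bd0_inj : forall e, injective (bd0 e);
  bd1_inj : forall e, injective (bd1 e)
}.

Section FundamentalGroup.
Variables (Gamma : graph) (GG : graph_of_groups Gamma) (T : subgraph Gamma).

Definition pi1_gen : choiceType :=
  ({v : vertex Gamma & vertex_group GG v} + edge Gamma)%type.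

Definition vgen v (x : vertex_group GG v) : word pi1_gen :=
  [:: (inl (Tagged (fun v => vertex_group GG v) x), false)].
Definition tgen (e : edge Gamma) : word pi1_gen := [:: (inr e, false)].

Inductive pi1_rel : word pi1_gen -> word pi1_gen -> Prop :=
| pi1_rel_vertex v (x y : vertex_group GG v) :
    pi1_rel (vgen x ++ vgen y) (vgen (x * y))
| pi1_rel_tree e : sub_edge T e -> pi1_rel (tgen e) [::]
| pi1_rel_edge e (x : edge_group GG e) :
    pi1_rel (vgen (bd0 GG e x))
            (tgen e ++ vgen (bd1 GG e x) ++ inv_word (tgen e)).

Definition pi1 : groupType := presented pi1_rel.

End FundamentalGroup.

(* Main.v *)
Require Import Defs.
From HB Require Import structures.
From mathcomp Require Import all_boot all_fingroup.
From mathcomp Require Import ssralg ssrint zmodp cyclic.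
From mathcomp Require Import zify generic_quotient.
From mathcomp Require Import boolp classical_sets cardinality.

Set Implicit Arguments.
Unset Strict Implicit.
Unset Printing Implicit Defensive.

Local Open Scope group_scope.

(** The proof separates two non-conjugate elements [x] and [y] by explicit
    finite permutation representations of the fundamental group.

    Let [P] be the product of the vertex groups; it is conjugacy separable,
    because non-conjugate elements differ in some coordinate. To give a
    homomorphism from the fundamental group to a finite group it suffices to
    give a finite quotient of [P] acting on a finite set [X] and, for each edge
    [e], a bijection of [X] that carries the first action of the edge group of
    [e] to the second one; conjugating by the values of the paths in the
    maximal tree then makes the tree edges trivial ([separation_criterion]).
    Such a bijection exists, and may be chosen to extend any given partial
    one, as soon as every subgroup of the edge group has as many fixed points
    for one action as for the other: this is Burnside's theorem that a finite
    set with a group action is determined by these numbers, its table of marks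
    ([equivariant_extension]). Up to conjugacy an element is either elliptic,
    that is, in a vertex group, or the value of a cyclically reduced closed
    path ([cyclic_normal_form]).

    If [x] and [y] are both elliptic, choose a finite quotient [Q] of [P] in
    which those of [x], [y] and the finitely many elements of the edge groups
    that are not conjugate in [P] remain so. The elements of [Q] that come from
    the conjugacy class of [x] form a set that is closed under conjugation in
    [Q] and under the identifications of the edge groups. For a finite group
    and a conjugation-invariant family of its subgroups there is a finite set
    on which the number of fixed points of a subgroup depends only on its order
    and on its membership in the family ([prescribed_marks]). Applied to [Q]
    times a cyclic group this yields edge bijections that preserve the
    distinction between [x] and [y] ([fusion_separation],
    [elliptic_separation]).

    If [x] is the value of a cyclically reduced path, lay this path out as a
    circle: a partial action on finitely many copies of [P] in which [x] fixes
    a point, with every point labelled by an element of the fundamental group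
    and the circle closing up only modulo multiplication by [x]. Enlarge the
    partial action by fresh copies of [P] until every rotation of the word for
    [y] can be followed from every edge of the circle ([extend_runs]). Then
    pass to a quotient [Q] of [P] that is injective on the finitely many
    elements involved, complete the partial action of [Q], which is free, and
    take its cyclic cover in which going once around the circle leads one sheet
    further. If [x] and [y] are conjugate there, then [y] moves some point
    exactly one sheet further, so its path crosses an edge of the circle. From
    this edge on, the path of the rotated [y] takes place in the part that is
    labelled, and comparing the labels at its two ends shows that [y] is
    conjugate to [x] ([hyperbolic_separation]). *)

(** * Extending partial equivariant bijections *)

Section EquivariantMatching.
Variables (gT : finGroupType) (X : finType) (a1 a2 : {action gT &-> X}).
Variable K : {group gT}.
Hypothesis same_marks : forall H : {group gT}, H \subset K ->
  #|'Fix_a1(H)| = #|'Fix_a2(H)|.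

(** A partial bijection, given by its graph, from the set with action [a1] to
    the set with action [a2], compatible with the actions of [K]. *)
Record matching (R : {set X * X}) : Prop := Matching {
  matching_act : forall x y k, k \in K -> (x, y) \in R ->
    (a1 x k, a2 y k) \in R;
  matching_fun : forall x y y', (x, y) \in R -> (x, y') \in R -> y = y';
  matching_inj : forall x x' y, (x, y) \in R -> (x', y) \in R -> x = x'
}.

Let dom (R : {set X * X}) := [set p.1 | p in R].
Let ran (R : {set X * X}) := [set p.2 | p in R].

Lemma matching_fixed R (H : {group gT}) x y : matching R -> H \subset K ->
  (x, y) \in R -> (x \in 'Fix_a1(H)) = (y \in 'Fix_a2(H)).
Proof.
move=> mR sHK Rxy; apply/afixP/afixP => fx h hH.
  have := matching_act mR (fintype.subsetP sHK h hH) Rxy.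
  by rewrite fx // => /(matching_fun mR Rxy).
have := matching_act mR (fintype.subsetP sHK h hH) Rxy.
by rewrite fx // => /(matching_inj mR Rxy).
Qed.

(** The marks of the matched parts agree because the matching identifies them,
    so the assumed equality passes to the unmatched parts. *)
Lemma unmatched_marks R (H : {group gT}) : matching R -> H \subset K ->
  #|'Fix_a1(H) :\: dom R| = #|'Fix_a2(H) :\: ran R|.
Proof.
move=> mR sHK; pose RH := [set p in R | p.1 \in 'Fix_a1(H)].
have inj1 : {in RH &, injective fst}.
  move=> [x y] [x' y'] /setIdP[Rxy _] /setIdP[Rxy' _] /= eqx.
  by move: Rxy'; rewrite -eqx => /(matching_fun mR Rxy) ->.
have inj2 : {in RH &, injective snd}.
  move=> [x y] [x' y'] /setIdP[Rxy _] /setIdP[Rxy' _] /= eqy.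
  by move: Rxy'; rewrite -eqy => /(matching_inj mR Rxy) ->.
have e1 : 'Fix_a1(H) :&: dom R = fst @: RH.
  apply/setP=> x; apply/setIP/imsetP.
    by case=> fx /imsetP[p Rp xp]; exists p; rewrite // inE Rp -xp.
  by case=> p /setIdP[Rp fp] ->; split=> //; apply: imset_f.
have e2 : 'Fix_a2(H) :&: ran R = snd @: RH.
  apply/setP=> y; apply/setIP/imsetP.
    case=> fy /imsetP[[x y'] Rp /= yp]; exists (x, y') => //.
    by rewrite inE Rp /= (matching_fixed mR sHK Rp) -yp.
  case=> -[x y'] /setIdP[Rp /= fp] ->; split; last exact: imset_f Rp.
  by rewrite -(matching_fixed mR sHK Rp).
have := same_marks sHK.
rewrite -(cardsID (dom R) 'Fix_a1(H)) -(cardsID (ran R) 'Fix_a2(H)).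
by rewrite e1 e2 (card_in_imset inj1) (card_in_imset inj2) => /addnI.
Qed.

(** An unmatched [x] with stabilizer [H] of maximal order has a possible
    partner: the mark of [H] shows that some unmatched [y] is fixed by [H], and
    the mark of the stabilizer of [y] together with maximality shows that this
    stabilizer is [H]. The orbits of [x] and [y] are then isomorphic. *)
Lemma extend_matching R x0 : matching R -> x0 \notin dom R ->
  exists2 R' : {set X * X}, matching R' & R \proper R'.
Proof.
move=> mR x0R; pose st (a : {action gT &-> X}) x := 'C_K[x | a].
have stS a x : st a x \subset K by apply: subsetIl.
have [x xR xmax] := @arg_maxnP _ x0 (fun x => x \notin dom R)
  (fun x => #|st a1 x|) x0R.
have fixst (a : {action gT &-> X}) z : z \in 'Fix_a('C_K[z | a]%G).
  by apply/afixP=> g /setIP[_ /astab1P].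
have : x \in 'Fix_a1('C_K[x | a1]%G) :\: dom R by rewrite inE xR fixst.
have [e0 xin|[y /setDP[fy yR]] _] :=
    set_0Vmem ('Fix_a2('C_K[x | a1]%G) :\: ran R).
  have : #|'Fix_a1('C_K[x | a1]%G) :\: dom R| = 0.
    by rewrite (unmatched_marks mR (stS a1 x)); apply/eqP; rewrite cards_eq0 e0.
  by move/cards0_eq => e1; move: xin; rewrite e1 inE.
have sxy : st a1 x \subset st a2 y.
  apply/fintype.subsetP=> g gx; rewrite inE (fintype.subsetP (stS a1 x) g gx).
  by apply/astab1P; apply: (afixP fy).
have exy : st a1 x = st a2 y.
  apply/eqP; rewrite eqEcard sxy.
  have [e0|[x' /setDP[fx' x'R]]] :=
      set_0Vmem ('Fix_a1('C_K[y | a2]%G) :\: dom R).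
    have : #|'Fix_a2('C_K[y | a2]%G) :\: ran R| = 0.
      rewrite -(unmatched_marks mR (stS a2 y)); apply/eqP.
      by rewrite cards_eq0 e0.
    by move/cards0_eq/setP/(_ y); rewrite inE yR fixst inE.
  apply: leq_trans (xmax x' x'R); apply: subset_leq_card.
  apply/fintype.subsetP=> g gy; rewrite inE (fintype.subsetP (stS a2 y) g gy).
  by apply/astab1P; apply: (afixP fx').
have same_st g h : g \in K -> h \in K ->
    (a1 x g == a1 x h) = (a2 y g == a2 y h).
  move=> gK hK; have ghK : g * h^-1 \in K by rewrite groupM ?groupV.
  have toE (a : {action gT &-> X}) z :
      (a z g == a z h) = (g * h^-1 \in st a z).
    rewrite inE ghK /=; apply/eqP/astab1P => [e|e].
      by rewrite actM e -actM mulgV act1.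
    by rewrite -[in RHS]e -actM mulgKV.
  by rewrite !toE exy.
have domP g : g \in K -> a1 x g \notin dom R.
  move=> gK; apply/negP=> /imsetP[[x1 y1] R1 /= e1]; move/negP: xR; apply.
  apply/imsetP; exists (x, a2 y1 g^-1) => //.
  rewrite (_ : x = a1 x1 g^-1); last by rewrite -e1 -actM mulgV act1.
  by apply: (matching_act mR); rewrite ?groupV.
have ranP g : g \in K -> a2 y g \notin ran R.
  move=> gK; apply/negP=> /imsetP[[x1 y1] R1 /= e1]; move/negP: yR; apply.
  apply/imsetP; exists (a1 x1 g^-1, y) => //.
  rewrite (_ : y = a2 y1 g^-1); last by rewrite -e1 -actM mulgV act1.
  by apply: (matching_act mR); rewrite ?groupV.
have inD z w : (z, w) \in R -> z \in dom R by move=> Rz; apply: imset_f Rz.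
have inN z w : (z, w) \in R -> w \in ran R.
  by move=> Rz; apply: (imset_f snd Rz).
exists (R :|: [set (a1 x g, a2 y g) | g in K]).
  split=> [z w k kK /setUP[Rz|/imsetP[g gK [-> ->]]]||].
  - by rewrite inE (matching_act mR kK Rz).
  - by rewrite -!actM inE [X in _ || X]imset_f ?orbT ?groupM.
  - move=> z w w' /setUP[Rz|/imsetP[g gK [-> ->]]] /setUP[Rz'|/imsetP[h hK []]].
    + exact: (matching_fun mR Rz Rz').
    + by move=> ez _; have := domP h hK; rewrite -ez (inD _ _ Rz).
    + by have := domP g gK; rewrite (inD _ _ Rz').
    + by move=> e ->; apply/eqP; rewrite -same_st // e.
  - move=> z z' w /setUP[Rz|/imsetP[g gK [-> ->]]] /setUP[Rz'|/imsetP[h hK []]].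
    + exact: (matching_inj mR Rz Rz').
    + by move=> _ ez; have := ranP h hK; rewrite -ez (inN _ _ Rz).
    + by have := ranP g gK; rewrite (inN _ _ Rz').
    + by move=> -> e; apply/eqP; rewrite same_st // e.
apply/properP; split; first exact: finset.subsetUl.
exists (x, y); last by apply: contra xR => /inD.
by rewrite inE; apply/orP; right; apply/imsetP; exists 1; rewrite ?act1.
Qed.

Lemma equivariant_extension R : matching R ->
  exists tau : {perm X}, (forall x y, (x, y) \in R -> tau x = y) /\
    forall x k, k \in K -> tau (a1 x k) = a2 (tau x) k.
Proof.
have [n] := ubnP #|~: R|; elim: n => // n IHn in R *; rewrite ltnS => leRn mR.
have [[x0 x0R]|domT] := pselect (exists x, x \notin dom R).
  have [R' mR' /properP[sRR' [p pR' pR]]] := extend_matching mR x0R.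
  have [|tau [tauR tauA]] := IHn R' _ mR'.
    apply: leq_trans leRn; apply: proper_card; apply/properP.
    by split; [rewrite finset.setCS | exists p; rewrite !inE ?pR ?pR'].
  by exists tau; split=> // x y Rxy; apply/tauR/(fintype.subsetP sRR').
have domS x : {y | (x, y) \in R}.
  apply: cid; apply: contrapT => nR; apply: domT; exists x.
  by apply/negP=> /imsetP[[x1 y1] R1 /= e]; apply: nR; exists y1; rewrite e.
have inj : injective (fun x => sval (domS x)).
  move=> x x' /= e; apply: (matching_inj mR (svalP (domS x))).
  by rewrite e; exact: (svalP (domS x')).
exists (perm inj); split=> [x y Rxy|x k kK]; rewrite !permE.
  exact: (matching_fun mR (svalP (domS x)) Rxy).
apply: (matching_fun mR (svalP (domS _))).
exact: (matching_act mR kK (svalP (domS x))).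
Qed.

End EquivariantMatching.

(** * Finite sets with prescribed numbers of fixed points *)

Section PrescribedMarks.
Variables (gT : finGroupType) (D : pred {group gT}).
Hypothesis DJ : forall (H : {group gT}) g, D (H :^ g)%G = D H.

Lemma conjG_bij (g : gT) : bijective (fun K : {group gT} => (K :^ g)%G).
Proof.
exists (fun K : {group gT} => (K :^ g^-1)%G) => K; apply: val_inj => /=.
  by rewrite conjsgK.
by rewrite conjsgKV.
Qed.

(** The equations for the weights [v] are triangular with respect to inclusion
    and are solved from the largest subgroups down. The number [T] is taken so
    large at each order that the weights come out non-negative; the factor 2
    leaves the parity free to record membership in [D]. *)
Lemma marks_weights : exists (v : {group gT} -> nat) (T : nat -> nat),
  (forall (K : {group gT}) g, v (K :^ g)%G = v K) /\
  forall H : {group gT},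
    (\sum_(K : {group gT} | H \subset K) v K = 2 * T #|H| + D H)%N.
Proof.
suff /(_ #|[set: gT]|.+1) : forall n,
    exists (v : {group gT} -> nat) (T : nat -> nat),
    (forall (K : {group gT}) g, v (K :^ g)%G = v K) /\
    forall H : {group gT}, (#|[set: gT]|.+1 - n <= #|H| ->
      \sum_(K : {group gT} | H \subset K) v K = 2 * T #|H| + D H)%N.
  by case=> v [T [vJ vT]]; exists v, T; split=> // H; apply: vT; rewrite subnn.
elim=> [|n [v [T [vJ vT]]]].
  exists (fun=> 0%N), (fun=> 0%N); split=> // H.
  by rewrite subn0 ltnNge subset_leq_card // finset.subsetT.
have [le_n|lt_n] := leqP #|[set: gT]|.+1 n.
  exists v, T; split=> // H _; apply: vT.
  by move: le_n; rewrite -subn_eq0 => /eqP->.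
set s := (_ - n)%N in vT; pose s' := (#|[set: gT]|.+1 - n.+1)%N.
have ss' : s = s'.+1 by rewrite /s /s' subnS prednK // subn_gt0.
pose t := (\sum_K v K)%N.
pose big (K : {group gT}) := (\sum_(K' : {group gT} | K \proper K') v K')%N.
have big_t K : (big K <= t)%N.
  by rewrite /t [leqRHS](bigID (fun K' : {group gT} => K \proper K')) leq_addr.
(* The weights of the subgroups of order [s'] are adjusted; [t] bounds what the
   larger subgroups contribute. *)
pose v' (K : {group gT}) :=
  if #|K| == s' then (2 * t + D K - big K)%N else v K.
exists v', (fun m => if m == s' then t else T m); split=> [K g|H le_s'H].
  rewrite /v' cardJg DJ vJ /big; case: ifP => // _; congr (_ - _)%N.
  rewrite (reindex _ (onW_bij _ (conjG_bij g))) /=; apply: eq_big => [K'|K' _].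
    by rewrite properJ.
  exact: vJ.
have v'big : (\sum_(K : {group gT} | H \proper K) v' K = big H)%N.
  apply: eq_bigr => K /proper_card ltHK; rewrite /v'.
  by rewrite gtn_eqF // (leq_ltn_trans le_s'H).
rewrite (bigD1 H) //=.
rewrite (eq_bigl (fun K : {group gT} => H \proper K)) ?v'big; last first.
  move=> K; rewrite finset.properEneq andbC; congr (_ && _).
  by rewrite eq_sym.
rewrite /v'; case: eqP => [eH|neH].
  rewrite subnK //; apply: leq_trans (big_t H) _.
  by rewrite mul2n -addnn -addnA leq_addr.
rewrite -vT; last by rewrite ss' ltn_neqAle le_s'H andbT eq_sym; apply/eqP.
rewrite [RHS](bigD1 H) //=; congr (_ + _)%N; apply: eq_bigl => K.
rewrite finset.properEneq andbC; congr (_ && _).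
by rewrite eq_sym.
Qed.

(** The set consists of the left cosets of all subgroups [K], permuted by right
    multiplication, each taken [v K * #|K|] times. A coset [q *: K] is fixed by
    [H] exactly when [H \subset K], so that [K] contributes
    [#|lcosets| * v K * #|K| = #|gT| * v K] fixed points. The triples that are
    not of this form are fixed by the whole group and account for [J]. *)
Lemma prescribed_marks : exists (X : finType) (act : {action gT &-> X})
    (T : nat -> nat) (J : nat), forall H : {group gT},
  #|'Fix_act(H)| = (#|[set: gT]| * (2 * T #|H| + D H) + J)%N.
Proof.
have [v [T [vJ vT]]] := marks_weights.
pose B := (\sum_K v K * #|gval K|)%N.
have vB K : (v K * #|gval K| <= B)%N by rewrite /B (bigD1 K) //= leq_addr.
pose X : finType := ({group gT} * {set gT} * 'I_B)%type.
pose good := [set x : X |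
  (x.1.2 \in lcosets x.1.1 [set: gT]) && (x.2 < v x.1.1 * #|x.1.1|)%N].
pose mv (x : X) g : X := ((x.1.1 :^ g)%G, x.1.2 :* g, x.2).
have mv_good x g : x \in good -> mv x g \in good.
  rewrite !inE /= vJ cardJg => /andP[/lcosetsP[q _ ->] ->]; rewrite andbT.
  apply/lcosetsP; exists (q * g); rewrite ?inE //.
  by rewrite conjsgE -lcosetM mulgK mulgA.
have act1' : (fun x g => if x \in good then mv x g else x)^~ 1 =1 id.
  move=> [[K S] i]; case: ifP => //= _; rewrite /mv /= rcoset1.
  by congr (_, _, _); apply: val_inj; rewrite /= conjsg1.
have actM' x g h : x \in good -> mv x (g * h) = mv (mv x g) h.
  move=> _; rewrite /mv /= rcosetM; congr (_, _, _).
  by apply: val_inj; rewrite /= conjsgM.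
pose to (x : X) g := if x \in good then mv x g else x.
have toM x : act_morph to x.
  move=> g h; rewrite /to; case: ifP => gx; last by rewrite gx.
  by rewrite mv_good // actM'.
exists X, (TotalAction act1' toM), T, #|~: good| => H.
pose fixd := [set x in good | H \subset x.1.1].
have -> : 'Fix_(TotalAction act1' toM)(H) = ~: good :|: fixd.
  apply/setP=> x; apply/afixP/idP => [fx|]; rewrite !inE.
    case: (boolP (_ && _)) => //= gx.
    apply/fintype.subsetP=> h hH; have := fx h hH; rewrite /= /to inE gx.
    case: x gx {fx} => [[K S] i] /= /andP[/lcosetsP[q _ ->] _] [_ eS].
    have : q * h \in q *: K by rewrite -eS mem_rcoset mulgK mem_lcoset mulVg.
    by rewrite mem_lcoset mulKg.
  rewrite /= /to => gx h hH; case: ifP => //; rewrite inE => gx'.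
  move: gx; rewrite gx' /= => sHx; have hx := fintype.subsetP sHx h hH.
  case: x gx' {sHx} hx => [[K S] i] /= /andP[/lcosetsP[q _ ->] _] hK.
  rewrite /mv /=; congr (_, _, _); first by apply: val_inj; rewrite /= conjGid.
  by rewrite -mulgA rcoset_id.
rewrite cardsU (_ : _ :&: _ = finset.set0) ?cards0 ?subn0 ; last first.
  by apply/setP=> x; rewrite !inE andbA andNb.
rewrite addnC; congr (_ + _)%N; rewrite -vT big_distrr /= -sum1_card.
rewrite (partition_big (fun x : X => x.1.1)
  (fun K : {group gT} => H \subset K)) /=; last by move=> x /setIdP[].
apply: eq_bigr => K sHK; rewrite sum1_card.
pose I := [set i : 'I_B | i < v K * #|gval K|].
have cardI : #|I| = (v K * #|gval K|)%N.
  rewrite -[RHS]card_ord -[RHS]sum1_card (big_ord_widen _ (fun=> 1%N) (vB K)).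
  by rewrite -sum1_card; apply: eq_bigl => i; rewrite inE.
transitivity #|finset.setX (lcosets K [set: gT]) I|; last first.
  rewrite cardsX cardI card_lcosets mulnCA (mulnC #|_ : _|).
  rewrite Lagrange ?finset.subsetT //.
  by rewrite mulnC.
rewrite -(card_imset (finset.setX _ I)
  (_ : injective (fun y => (K, y.1, y.2)))); last first.
  by move=> [S i] [S' i'] [-> ->].
apply: eq_card => -[[K' S] i]; rewrite unfold_in /=; apply/andP/imsetP.
  rewrite !inE => -[/andP[gx _] /eqP eK]; exists (S, i); rewrite -?eK //.
  by rewrite !inE /= -eK.
by move=> [[S' i'] /setXP[/= lS lI] [-> -> ->]]; move: lI;
  rewrite !inE /= lS sHK eqxx => ->.
Qed.

End PrescribedMarks.

(** * Finite quotients and products of groups *)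

Lemma conjugate_elts_sym (G : groupType) (x y : G) :
  conjugate_elts x y -> conjugate_elts y x.
Proof. by move=> [g <-]; exists g^-1; rewrite conjgK. Qed.

Lemma conjugate_elts_trans (G : groupType) (y x z : G) :
  conjugate_elts x y -> conjugate_elts y z -> conjugate_elts x z.
Proof. by move=> [g <-] [h <-]; exists (g * h); rewrite conjgM. Qed.

Lemma mor1 (G H : groupType) (f : {multiplicative G -> H}) : f 1 = 1.
Proof. by apply: (@mulgI _ (f 1)); rewrite -gmulfM !mulg1. Qed.

Lemma morV (G H : groupType) (f : {multiplicative G -> H}) x :
  f x^-1 = (f x)^-1.
Proof. by apply: (@mulgI _ (f x)); rewrite -gmulfM !mulgV mor1. Qed.

Lemma morJ (G H : groupType) (f : {multiplicative G -> H}) x y :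
  f (x ^ y) = f x ^ f y.
Proof. by rewrite /conjg !gmulfM morV. Qed.

(** The proof is an argument of the function, so that its morphism structure
    can be inferred. *)
Definition as_mor (G H : groupType) (f : G -> H)
  (fM : {morph f : x y / x * y}) : G -> H := f.
HB.instance Definition _ (G H : groupType) (f : G -> H)
  (fM : {morph f : x y / x * y}) :=
  isMultiplicative.Build G H (as_mor fM) fM.

(** Conjugacy is tested in the image of [f] only: this form lets the target be a
    convenient large group, such as a symmetric group. *)
Definition finitely_separated (G : groupType) (x y : G) : Prop :=
  exists (L : finGroupType) (f : {multiplicative G -> L}),
    forall g : G, f x ^ f g <> f y.

Lemma finitely_separated_sym (G : groupType) (x y : G) :
  finitely_separated x y -> finitely_separated y x.
Proof.
move=> [L [f fP]]; exists L, f => g e; apply: (fP g^-1).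
by rewrite morV -e conjgK.
Qed.

Section Corestriction.
Variables (G : groupType) (L : finGroupType) (f : {multiplicative G -> L}).

Let im : {set L} := [set l | `[< exists g, f g = l >]].

Lemma image_group_set : group_set im.
Proof.
apply/group_setP; split; first by rewrite inE; apply/asboolP; exists 1;
  apply: mor1.
move=> x y; rewrite !inE => -[g gx] [h hy].
by exists (g * h); rewrite gmulfM gx hy.
Qed.

Let imG := Group image_group_set.

Let mem_im g : f g \in imG. Proof. by rewrite inE; apply/asboolP; exists g. Qed.

Definition corestr (g : G) : subg_of imG := subg imG (f g).

Lemma corestrM : {morph corestr : x y / x * y}.
Proof. by move=> x y; rewrite /corestr gmulfM subgM. Qed.

HB.instance Definition _ := isMultiplicative.Build G (subg_of imG) corestr
  corestrM.

Lemma finite_image : exists (Q : finGroupType) (h : {multiplicative G -> Q}),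
  (forall q, exists g, h g = q) /\
  forall x y, conjugate_elts (h x) (h y) -> exists g, f x ^ f g = f y.
Proof.
have surj q : exists g, corestr g = q.
  have := subgP q; rewrite inE => /asboolP[g e].
  by exists g; rewrite /corestr e sgvalK.
exists (subg_of imG), corestr; split=> // x y [q]; have [g <-] := surj q.
rewrite -(morJ corestr) => /(congr1 sgval); rewrite !subgK // => <-.
by exists g; rewrite morJ.
Qed.

End Corestriction.

Lemma conjugacy_separableP (G : groupType) :
  (forall x y : G, ~ conjugate_elts x y -> finitely_separated x y) ->
  conjugacy_separable G.
Proof.
move=> sep x y /sep[L [f fP]]; have [Q [h [hS hP]]] := finite_image f.
by exists Q, h; split=> // /hP[g]; apply: fP.
Qed.

Section PairMorphism.
Variables (G : groupType) (Q1 Q2 : finGroupType).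
Variables (f1 : {multiplicative G -> Q1}) (f2 : {multiplicative G -> Q2}).

Definition pair_mor (g : G) : Q1 * Q2 := (f1 g, f2 g).

Lemma pair_morM : {morph pair_mor : x y / x * y}.
Proof. by move=> x y; rewrite /pair_mor !gmulfM. Qed.

HB.instance Definition _ := isMultiplicative.Build G (Q1 * Q2)%type pair_mor
  pair_morM.
End PairMorphism.

(** The product of the quotients that serve the single pairs serves all of
    them. *)
Lemma separate_pairs (G : groupType) (s : seq (G * G)) :
  conjugacy_separable G ->
  exists (Q : finGroupType) (f : {multiplicative G -> Q}),
    forall p, p \in s -> conjugate_elts (f p.1) (f p.2) ->
      conjugate_elts p.1 p.2.
Proof.
move=> csG; elim: s => [|p s [Q1 [f1 f1P]]].
  by exists (perm_of unit), (@one_fun G (perm_of unit)).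
have [Q2 [f2 f2P]] : exists (Q : finGroupType) (f : {multiplicative G -> Q}),
    conjugate_elts (f p.1) (f p.2) -> conjugate_elts p.1 p.2.
  have [cp|ncp] := pselect (conjugate_elts p.1 p.2).
    by exists Q1, f1.
  by have [Q [f [_ fP]]] := csG _ _ ncp; exists Q, f.
exists (Q1 * Q2)%type, (pair_mor f1 f2) => q;
  rewrite inE => /predU1P[->|qs] [g].
  by move=> [_ e]; apply: f2P; exists g.2.
by move=> [e _]; apply: f1P => //; exists g.1.
Qed.

Lemma separate_conjugates (G : groupType) (s : seq G) : conjugacy_separable G ->
  exists (Q : finGroupType) (f : {multiplicative G -> Q}),
    {in s &, forall x y, conjugate_elts (f x) (f y) -> conjugate_elts x y}.
Proof.
move=> /(@separate_pairs _ [seq (x, y) | x <- s, y <- s])[Q [f fP]].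
exists Q, f => x y xs ys; apply: (fP (x, y)); exact: allpairs_f.
Qed.

(** Apply the separation of conjugacy classes to the quotients of the elements,
    each compared with 1. *)
Lemma separate_elements (G : groupType) (s : seq G) : conjugacy_separable G ->
  exists (Q : finGroupType) (f : {multiplicative G ->
    Q}), {in s &, injective f}.
Proof.
move=> /(@separate_pairs _ [seq (x * y^-1, 1) | x <- s, y <- s])[Q [f fP]].
exists Q, f => x y xs ys exy.
have [||g] := fP (x * y^-1, 1).
- by apply/allpairsP; exists (x, y).
- by exists 1; rewrite /= conjg1 mor1 gmulfM morV exy mulgV.
rewrite /= => e; apply: divg1_eq; apply: (@conjg_inj _ g).
by rewrite e conj1g.
Qed.

Definition prodgroup (I : Type) (G : I -> groupType) : Type := forall i, G i.

Section ProductGroup.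
Variables (I : choiceType) (G : I -> groupType).
Local Notation P := (prodgroup G).

HB.instance Definition _ := gen_eqMixin P.
HB.instance Definition _ := gen_choiceMixin P.

Definition prod_one : P := fun i => 1.
Definition prod_mul (p q : P) : P := fun i => p i * q i.
Definition prod_inv (p : P) : P := fun i => (p i)^-1.

Lemma prod_mulA : associative prod_mul.
Proof. by move=> p q r; apply: functional_extensionality_dep => i;
  apply: mulgA. Qed.
Lemma prod_mul1 : left_id prod_one prod_mul.
Proof. by move=> p; apply: functional_extensionality_dep => i;
  apply: mul1g. Qed.
Lemma prod_1mul : right_id prod_one prod_mul.
Proof. by move=> p; apply: functional_extensionality_dep => i;
  apply: mulg1. Qed.
Lemma prod_mulV : left_inverse prod_one prod_inv prod_mul.
Proof. by move=> p; apply: functional_extensionality_dep => i;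
  apply: mulVg. Qed.
Lemma prod_Vmul : right_inverse prod_one prod_inv prod_mul.
Proof. by move=> p; apply: functional_extensionality_dep => i;
  apply: mulgV. Qed.

HB.instance Definition _ :=
  isGroup.Build P prod_mulA prod_mul1 prod_1mul prod_mulV prod_Vmul.

Definition coord i (p : P) : G i := p i.
HB.instance Definition _ i :=
  isMultiplicative.Build P (G i) (@coord i) (fun p q => erefl).

(** If all coordinates were conjugate, a choice of conjugating elements would
    conjugate the two families. *)
Lemma prodgroup_conjugacy_separable :
  (forall i, conjugacy_separable (G i)) -> conjugacy_separable P.
Proof.
move=> csG; apply: conjugacy_separableP => p q ncpq.
have [i nci] : exists i, ~ conjugate_elts (p i) (q i).
  apply: contrapT => /forallNP cpq; apply: ncpq.
  have {}cpq i : {g | p i ^ g = q i}.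
    by apply: cid; apply: contrapT (cpq i).
  exists (fun i => sval (cpq i)); apply: functional_extensionality_dep => i.
  exact: svalP (cpq i).
have [Q [f [_ fP]]] := csG i _ _ nci.
exists Q, (f \o @coord i) => g e; apply: fP; exists (f (g i)); exact: e.
Qed.

Definition inj_at i (x : G i) : P := dfwith prod_one x.

Lemma inj_at_in i (x : G i) : inj_at x i = x.
Proof. exact: dfwith_in. Qed.

Lemma inj_at_out i (x : G i) j : i != j -> inj_at x j = 1.
Proof. exact: dfwith_out. Qed.

Lemma inj_atM i : {morph @inj_at i : x y / x * y}.
Proof.
move=> x y; apply: functional_extensionality_dep => j;
  rewrite /mul /= /prod_mul.
have [->|ne] := eqVneq j i; first by rewrite !inj_at_in.
by rewrite !inj_at_out 1?eq_sym // mulg1.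
Qed.
HB.instance Definition _ i := isMultiplicative.Build (G i) P (@inj_at i)
  (@inj_atM i).

End ProductGroup.

(** * Walks and spanning trees *)

Lemma repeatP (I : eqType) (A : Type) (f : A -> I) (p : seq A) :
  ~~ uniq (map f p) ->
  exists p1 a p2 b p3, p = p1 ++ a :: p2 ++ b :: p3 /\ f a = f b.
Proof.
elim: p => //= a p IHp; rewrite negb_and negbK => /orP[|/IHp].
  elim: p {IHp} => //= b p IHp; rewrite inE => /predU1P[e|].
    by exists [::], a, [::], b, p.
  case/IHp=> p1 [a' [p2 [b' [p3 [e ef]]]]]; case: p1 e => [|c p1] [ea ep].
    by exists [::], a, (b :: p2), b', p3; rewrite ep ea.
  by exists (a :: b :: p1), a', p2, b', p3; rewrite ep.
by case=> p1 [a' [p2 [b' [p3 [-> ef]]]]]; exists (a :: p1), a', p2, b', p3.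
Qed.

Section Walks.
Variable Gamma : graph.
Implicit Types (x y z : vertex Gamma) (a b : step Gamma).
Implicit Types p q : seq (step Gamma).

Definition rev_step a : step Gamma := (a.1, ~~ a.2).

Definition walk_end x p := last x (map (@step_tgt Gamma) p).

Lemma src_rev a : step_src (rev_step a) = step_tgt a.
Proof. by case: a => e []. Qed.
Lemma tgt_rev a : step_tgt (rev_step a) = step_src a.
Proof. by case: a => e []. Qed.

Lemma walk_cat x p q y :
  walk x (p ++ q) y = walk x p (walk_end x p) && walk (walk_end x p) q y.
Proof.
elim: p x => [|a p IHp] x /=; first by rewrite /walk_end /= eqxx.
by rewrite IHp /walk_end /= andbA.
Qed.

Lemma walk_endE x p y : walk x p y -> walk_end x p = y.
Proof.
elim: p x => [|a p IHp] x /=; first by move/eqP.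
by case/andP=> _ /IHp.
Qed.

Lemma walk_trans x p y q z : walk x p y -> walk y q z -> walk x (p ++ q) z.
Proof. by move=> wp wq; rewrite walk_cat (walk_endE wp) wp. Qed.

Lemma walk_rev x p y : walk x p y -> walk y (rev (map rev_step p)) x.
Proof.
elim: p x => [|a p IHp] x /=; first by rewrite eq_sym.
case/andP=> /eqP <- /IHp wp; rewrite rev_cons -cats1.
by apply: walk_trans wp _; rewrite /= src_rev tgt_rev !eqxx.
Qed.

Section WalkValue.
Variables (L : groupType) (tau : edge Gamma -> L).

Definition step_val a : L := if a.2 then (tau a.1)^-1 else tau a.1.
Definition walk_val p : L := foldr (fun a l => step_val a * l) 1 p.

Lemma walk_val_cat p q : walk_val (p ++ q) = walk_val p * walk_val q.
Proof. by elim: p => [|a p IHp] /=; rewrite ?mul1g // IHp mulgA. Qed.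

Lemma step_val_rev a : step_val (rev_step a) = (step_val a)^-1.
Proof. by case: a => e []; rewrite /step_val /= ?invgK. Qed.

(** A closed walk that is not a circuit visits a vertex twice, and splits there
    into two shorter closed walks, or it uses an edge twice in opposite
    directions, and then the part in between is a shorter closed walk between
    two steps that cancel. *)
Lemma circuitless_walk_val (S : subgraph Gamma) :
  (forall p, walk_in S p -> ~ circuit p) ->
  forall x p, walk_in S p -> walk x p x -> walk_val p = 1.
Proof.
move=> noc x p; have [n] := ubnP (size p).
elim: n => // n IHn in x p *; rewrite ltnS => le_pn Sp wp.
have shorter x' p' q : walk_in S p' -> walk x' p' x' ->
    size p = (size p' + size q).+1 -> walk_val p' = 1.
  move=> Sp' wp' sz; apply: IHn wp' => //; apply: leq_trans le_pn.
  by rewrite sz ltnS leq_addr.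
have [ut|/repeatP] := boolP (uniq (map (@step_tgt Gamma) p)); last first.
  case=> p1 [a [p2 [b [p3 [ep eab]]]]]; move: wp; rewrite {1}ep walk_cat /=.
  case/and3P=> w1 sa; rewrite walk_cat /= => /and3P[w2 sb w3].
  have v2 : walk_val (p2 ++ [:: b]) = 1.
    apply: (shorter (step_tgt a) _ (p1 ++ p3)).
    - by move=> c cp; apply: Sp; rewrite ep !(mem_cat, inE) in cp *;
        case/orP: cp => ->; rewrite ?orbT.
    - by rewrite walk_cat w2 /= sb eab eqxx.
    - by rewrite ep !(size_cat, size_rcons) /= !(size_cat, size_rcons) /=; lia.
  have v1 : walk_val (p1 ++ a :: p3) = 1.
    apply: (shorter x _ p2).
    - by move=> c cp; apply: Sp; rewrite ep !(mem_cat, inE) in cp *;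
        case/or3P: cp => ->; rewrite ?orbT.
    - by rewrite walk_cat w1 /= sa eab.
    - by rewrite ep !(size_cat, size_rcons) /= !(size_cat, size_rcons) /=; lia.
  rewrite ep -(cat1s b) (catA p2) walk_val_cat /= walk_val_cat v2 mul1g.
  by rewrite -v1 walk_val_cat.
have [ue|/repeatP] := boolP (uniq (map fst p)).
  by case: p {le_pn shorter} Sp wp ut ue => // a p Sp wp ut ue;
    case: (noc _ Sp); split=> //; exists x.
case=> p1 [a [p2 [b [p3 [ep eab]]]]].
have eb : b = rev_step a.
  case: a b eab ep => [e i] [e' j] /= <- ep; congr (_, _).
  case: (eqVneq j i) => [eij|]; last by case: i {ep}; case: j.
  move: ut; rewrite ep eij map_cat cat_uniq => /and3P[_ _] /=.
  by rewrite map_cat /= mem_cat !inE eqxx orbT.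
move: wp; rewrite {1}ep walk_cat /=.
case/and3P=> w1 sa; rewrite walk_cat eb /= src_rev => /and3P[w2 sb w3].
have v2 : walk_val p2 = 1.
  apply: (shorter (step_tgt a) _ (p1 ++ a :: p3)).
  - by move=> c cp; apply: Sp; rewrite ep !(mem_cat, inE) cp ?orbT.
  - by move: w2; rewrite -(eqP sb).
  - by rewrite ep !(size_cat, size_rcons) /= !(size_cat, size_rcons) /=; lia.
have v1 : walk_val (p1 ++ p3) = 1.
  apply: (shorter x _ (rcons p2 a)).
  - by move=> c cp; apply: Sp; rewrite ep !(mem_cat, inE) in cp *;
      case/orP: cp => ->; rewrite ?orbT.
  - by rewrite walk_cat w1 /= -(eqP sa); move: w3; rewrite tgt_rev.
  - by rewrite ep !(size_cat, size_rcons) /= !(size_cat, size_rcons) /=; lia.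
rewrite ep walk_val_cat /= walk_val_cat /= v2 mul1g eb step_val_rev mulKVg.
by rewrite -walk_val_cat.
Qed.

End WalkValue.
End Walks.

Section Spanning.
Variable Gamma : graph.

Definition joined (S : subgraph Gamma) x y :=
  exists p, walk x p y /\ walk_in S p.

Lemma joined_refl S x : joined S x x.
Proof. by exists [::]; split=> //=. Qed.

Lemma joined_trans S x y z : joined S x y -> joined S y z -> joined S x z.
Proof.
move=> [p [wp Sp]] [q [wq Sq]]; exists (p ++ q).
split; first exact: walk_trans wp wq.
by move=> a; rewrite mem_cat => /orP[/Sp|/Sq].
Qed.

Lemma joined_sym S x y : joined S x y -> joined S y x.
Proof.
move=> [p [wp Sp]]; exists (rev (map (@rev_step Gamma) p)).
split; first exact: walk_rev.
by move=> a; rewrite mem_rev => /mapP[b /Sp Sb ->].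
Qed.

Lemma joined_step (S : subgraph Gamma) a :
  sub_edge S a.1 -> joined S (step_src a) (step_tgt a).
Proof. by move=> Sa; exists [:: a]; split=> [|b];
  rewrite /= ?eqxx // inE => /eqP->. Qed.

Lemma sub_step (S : subgraph Gamma) a : sub_edge S a.1 ->
  sub_vertex S (step_src a) /\ sub_vertex S (step_tgt a).
Proof.
by case: a => e [] /= Se; split; rewrite /step_src /step_tgt /=;
   first [exact: sub_d0 Se | exact: sub_d1 Se].
Qed.

Lemma circuit_next (p : seq (step Gamma)) x b : walk x p x -> b \in p ->
  exists2 c, c \in p & step_src c = step_tgt b.
Proof.
move=> wp /splitPr bp; case: bp wp => p1 p2; rewrite walk_cat /=.
case/and3P=> w1 sb; case: p2 => [|c p2] /=.
  move=> /eqP tb; case: p1 w1 sb => [|c p1] /=.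
    by move=> _ /eqP sb; exists b; rewrite ?inE // tb sb.
  by case/andP=> /eqP sc _ _; exists c; rewrite ?inE ?eqxx // sc.
by case/andP=> /eqP sc _; exists c => //; rewrite mem_cat !inE eqxx !orbT.
Qed.

Lemma uniq_map_inj (A B : eqType) (f : A -> B) (s : seq A) :
  uniq (map f s) -> {in s &, injective f}.
Proof.
elim: s => // c s IHs /= /andP[nc us] a b; rewrite !inE.
move=> /predU1P[->|sa] /predU1P[->|sb] // e; last exact: IHs.
  by move: nc; rewrite e map_f.
by move: nc; rewrite -e map_f.
Qed.

Lemma step_eq_or_rev (a b : step Gamma) : a.1 = b.1 -> a = b \/ a = rev_step b.
Proof.
case: a b => [e i] [_ j] /= <-; rewrite /rev_step /=.
by case: i; case: j; [left|right|right|left].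
Qed.

Section AddLeaf.
Variables (S : subgraph Gamma) (a : step Gamma).
Hypothesis Ssrc : sub_vertex S (step_src a).
Hypothesis Stgt : ~ sub_vertex S (step_tgt a).

Let V : set (vertex Gamma) := fun v => sub_vertex S v \/ v = step_tgt a.
Let E : set (edge Gamma) := fun e => sub_edge S e \/ e = a.1.

Let E0 e : E e -> V (d0 e).
Proof.
case=> [Se|->]; first by left; apply: sub_d0.
by move: Ssrc; rewrite /V /step_tgt /step_src; case: a.2; [right|left].
Qed.

Let E1 e : E e -> V (d1 e).
Proof.
case=> [Se|->]; first by left; apply: sub_d1.
by move: Ssrc; rewrite /V /step_tgt /step_src; case: a.2; [left|right].
Qed.

Definition add_leaf := Subgraph E0 E1.

Lemma joined_add_leaf x y : joined S x y -> joined add_leaf x y.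
Proof. by move=> [p [wp Sp]]; exists p; split=> // b /Sp; left. Qed.

(** A circuit through the new edge would enter and leave the new vertex by that
    same edge, the only one there. *)
Lemma add_leaf_subtree : subtree S -> subtree add_leaf.
Proof.
move=> [Sc Snc]; have ja : joined add_leaf (step_src a) (step_tgt a).
  by apply: joined_step; right.
split=> [x y [Sx|->] [Sy|->]|p Sp cp].
- by apply: joined_add_leaf; apply: Sc.
- by apply: joined_trans ja; apply: joined_add_leaf; apply: Sc.
- apply: joined_trans (joined_sym ja) _.
  by apply: joined_add_leaf; apply: Sc.
- exact: joined_refl.
have [pa|pa] := boolP (a.1 \in map fst p); last first.
  apply: (Snc p) => // b bp; case: (Sp b bp) => // e.
  by move: pa; rewrite -e map_f.
case: cp => _ [x wp] _ ue; have inj := uniq_map_inj ue.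
have only b : b \in p -> step_tgt b = step_tgt a \/ step_src b = step_tgt a ->
    b.1 = a.1.
  move=> bp tb; case: (Sp b bp) => // /sub_step[Ss St].
  by case: Stgt; case: tb => <-.
have neq : step_tgt a <> step_src a by move=> e; apply: Stgt; rewrite e.
have no_tgt b : b \in p -> step_tgt b <> step_tgt a.
  move=> bp tb; have [c cp sc] := circuit_next wp bp.
  have eb := only b bp (or_introl tb).
  have ec : c.1 = a.1 by apply: only cp _; right; rewrite sc.
  have ecb : c = b by apply: inj; rewrite // ec eb.
  have [eba|eba] := step_eq_or_rev eb.
    by apply: neq; rewrite -{1}tb -sc ecb eba.
  by apply: neq; rewrite -tb eba tgt_rev.
have [b bp eb] := mapP pa.
have [eba|eba] := step_eq_or_rev (esym eb).
  by apply: (no_tgt b bp); rewrite eba.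
have wr := walk_rev wp.
have [c cp sc] : exists2 c, c \in p & step_tgt c = step_src b.
  have [|c'] := circuit_next wr (b := rev_step b).
    by rewrite mem_rev map_f.
  rewrite mem_rev tgt_rev => /mapP[c cp ->] e.
  by exists c; rewrite // -src_rev.
by apply: (no_tgt c cp); rewrite sc eba src_rev.
Qed.
End AddLeaf.

Lemma leaving_step (A : set (vertex Gamma)) p x y : walk x p y -> A x ->
  ~ A y ->
  exists2 a, A (step_src a) & ~ A (step_tgt a).
Proof.
elim: p x => [|a p IHp] x /=; first by move/eqP=> -> ? /(_ _).
case/andP=> /eqP sx wp Ax nAy; have [At|nAt] := pselect (A (step_tgt a)).
  exact: IHp wp At nAy.
by exists a; rewrite ?sx.
Qed.

(** A walk from the tree to a missed vertex leaves the tree by an edge that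
    could be added to it. *)
Lemma maximal_subtree_spanning (T : subgraph Gamma) :
  connected_graph Gamma -> maximal_subtree T -> forall v, sub_vertex T v.
Proof.
move=> conn [Ttree Tmax] v; apply: contrapT => nTv.
have [[r Tr]|T0] := pselect (exists r, sub_vertex T r).
  have [p [wp _]] := conn r v I I.
  have [a Ts nTt] := leaving_step wp Tr nTv.
  have [|||/(_ (step_tgt a)) H _] := Tmax (add_leaf Ts).
  - exact: add_leaf_subtree.
  - by move=> x Tx; left.
  - by move=> x Tx; left.
  by apply: nTt; apply: H; right.
(* If [T] is empty, a single vertex is a larger tree. *)
pose S := @Subgraph Gamma (fun x => x = v) (fun=> False)
  (fun _ => False_ind _) (fun _ => False_ind _).
have noT x : ~ sub_vertex T x by move=> Tx; apply: T0; exists x.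
have [|||/(_ v erefl)] := Tmax S.
- split=> [x y -> ->|p Sp]; first exact: joined_refl.
  by case: p Sp => [_ []|b p /(_ b (mem_head _ _))].
- by move=> x /noT.
- by move=> e /sub_d0/noT.
by move/noT.
Qed.

End Spanning.

(** * Maps out of a presented group *)

Section UniversalProperty.
Variables (X : choiceType) (R : word X -> word X -> Prop) (L : groupType).
Variable phi : X -> L.

Definition letter_val (a : X * bool) : L :=
  if a.2 then (phi a.1)^-1 else phi a.1.
Definition word_val (w : word X) : L := foldr (fun a l => letter_val a * l) 1 w.

Lemma word_val_cat u v : word_val (u ++ v) = word_val u * word_val v.
Proof. by elim: u => [|a u IHu] /=; rewrite ?mul1g // IHu mulgA. Qed.

Definition respects_relations : Prop :=
  forall u v, R u v -> word_val u = word_val v.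

Lemma word_val_eq u v :
  respects_relations -> word_eq R u v -> word_val u = word_val v.
Proof.
move=> RP.
elim=> {u v} [u v /RP //|[x b]||u v _ ->|u v w _ ->
  _ ->|u u' v v' _ eu _ ev] //.
  by case: b; rewrite /letter_val /= ?mulg1 ?mulgV ?mulVg.
by rewrite !word_val_cat eu ev.
Qed.

Definition presented_lift (RP : respects_relations) (c : presented R) : L :=
  word_val (repr c).

Variable RP : respects_relations.

Lemma presented_liftE w : presented_lift RP (pclass R w) = word_val w.
Proof. by apply: word_val_eq => //; apply/pclassP; rewrite pclass_repr. Qed.

Lemma presented_liftM : {morph presented_lift RP : x y / x * y}.
Proof.
by move=> x y; rewrite /mul /= /presented_mul presented_liftE word_val_cat.
Qed.

HB.instance Definition _ := isMultiplicative.Build (presented R) L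
  (presented_lift RP) presented_liftM.
End UniversalProperty.

Lemma presented_ind (X : choiceType) (R : word X -> word X -> Prop)
    (A : presented R -> Prop) :
  A 1 -> (forall x y, A x -> A y -> A (x * y)) ->
  (forall a, A (pclass R [:: a])) -> forall c, A c.
Proof.
move=> A1 AM Ag c; rewrite -(pclass_repr c).
elim: (repr c) => [|a w IHw]; first exact: A1.
by rewrite -cat1s -pclassM; apply: (AM _ _ _ IHw).
Qed.

Lemma pclass_inv (X : choiceType) (R : word X -> word X -> Prop) x :
  pclass R [:: (x, true)] = (pclass R [:: (x, false)])^-1.
Proof. by rewrite /inv /= pclassV. Qed.

(** * Path words and the cyclic normal form *)

Section PathWords.
Variables (Gamma : graph) (GG : graph_of_groups Gamma).
Local Notation V := (vertex Gamma).
Local Notation P := (prodgroup (vertex_group GG)).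
Local Notation at_v v x := (@inj_at V (vertex_group GG) v x).

(** Elements of the vertex groups are handled inside the product [P] of all of
    them, which avoids casts between vertex groups with equal indices. *)
Definition supported (v : V) (p : P) : Prop := p = at_v v (p v).

Lemma supported_inj_at v x : supported v (at_v v x).
Proof. by rewrite /supported inj_at_in. Qed.

Lemma supported1 v : supported v 1.
Proof. exact: esym (mor1 (@inj_at V (vertex_group GG) v)). Qed.

Lemma supportedM v p q : supported v p -> supported v q -> supported v (p * q).
Proof. by rewrite /supported => {1}-> {1}->; rewrite -inj_atM. Qed.

(** The image of the edge group at the source of the step [a]; the other image
    is the one for [rev_step a]. *)
Definition attach (a : step Gamma) (c : edge_group GG a.1) : P :=
  if a.2 then at_v (d1 a.1) (bd1 GG a.1 c) else at_v (d0 a.1) (bd0 GG a.1 c).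

Lemma supported_attach a c : supported (step_src a) (@attach a c).
Proof. by rewrite /attach /step_src; case: a.2; apply: supported_inj_at. Qed.

Lemma inj_at_inj v : injective (@inj_at V (vertex_group GG) v).
Proof. by move=> x y /(congr1 (fun p : P => p v)); rewrite !inj_at_in. Qed.

Lemma attach_inj a : injective (@attach a).
Proof.
rewrite /attach; case: a.2 => c c' /inj_at_inj; [exact: bd1_inj|exact: bd0_inj].
Qed.

Lemma attachM a : {morph @attach a : c c' / c * c'}.
Proof. by rewrite /attach; case: a.2 => c c'; rewrite gmulfM inj_atM. Qed.

HB.instance Definition _ a :=
  isMultiplicative.Build (edge_group GG a.1) P (@attach a) (@attachM a).

(** A syllable is a vertex element followed by a step that starts at its
    vertex. *)
Definition path_word := seq (P * step Gamma).

Fixpoint composable (v : V) (l : path_word) (w : V) : Prop :=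
  if l is s :: l' then
    [/\ step_src s.2 = v, supported v s.1 & composable (step_tgt s.2) l' w]
  else v = w.

Lemma composable_cat u l v m w :
  composable u l v -> composable v m w -> composable u (l ++ m) w.
Proof. by elim: l u => [|s l IHl] u /= => [->|[su iu lv] mw] //; split;
  auto. Qed.

Lemma composable_catE u l m w : composable u (l ++ m) w ->
  exists2 v, composable u l v & composable v m w.
Proof.
elim: l u => [|s l IHl] u /=; first by exists u.
by case=> su iu /IHl[v lv mw]; exists v.
Qed.

Section PathValue.
Variables (H : groupType) (psi : V -> P -> H) (tau : edge Gamma -> H).

Definition path_val (l : path_word) : H :=
  foldr (fun s h => psi (step_src s.2) s.1 * (step_val tau s.2 * h)) 1 l.

Lemma path_val_cat l m : path_val (l ++ m) = path_val l * path_val m.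
Proof. by elim: l => [|s l IHl] /=; rewrite ?mul1g // IHl !mulgA. Qed.
End PathValue.

Variable T : subgraph Gamma.
Local Notation G := (pi1 GG T).

Definition vertex_elt (v : V) (p : P) : G := pclass (pi1_rel T) (vgen (p v)).

Lemma vertex_eltM v : {morph vertex_elt v : p q / p * q}.
Proof.
move=> p q; apply/esym; rewrite /vertex_elt [LHS]pclassM; apply/pclassP.
exact/word_eq_rel/pi1_rel_vertex.
Qed.
HB.instance Definition _ v :=
  isMultiplicative.Build P G (vertex_elt v) (@vertex_eltM v).

Definition edge_elt (e : edge Gamma) : G := pclass (pi1_rel T) (tgen GG e).

Lemma edge_relation e c :
  vertex_elt (d0 e) (at_v (d0 e) (bd0 GG e c)) * edge_elt e =
  edge_elt e * vertex_elt (d1 e) (at_v (d1 e) (bd1 GG e c)).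
Proof.
rewrite /vertex_elt !inj_at_in; apply: (canLR (mulgVK _)); rewrite -mulgA.
have pM (u v : word (pi1_gen GG)) :
  pclass (pi1_rel T) u * pclass (pi1_rel T) v = pclass (pi1_rel T) (u ++ v).
  exact: pclassM.
have pV (u : word (pi1_gen GG)) :
  (pclass (pi1_rel T) u)^-1 = pclass (pi1_rel T) (inv_word u).
  exact: pclassV.
rewrite /edge_elt pV (pM (vgen _)) (pM (tgen _ _) _).
exact/pclassP/word_eq_rel/pi1_rel_edge.
Qed.

Lemma step_relation (a : step Gamma) (c : edge_group GG a.1) :
  vertex_elt (step_src a) (attach c) * step_val edge_elt a =
  step_val edge_elt a * vertex_elt (step_tgt a) (@attach (rev_step a) c).
Proof.
have := edge_relation c; rewrite /attach /step_val /step_src /step_tgt /rev_step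
  /=.
case: a.2 => //= e; apply: (@mulgI _ (edge_elt a.1)).
by rewrite mulKVg mulgA -e mulgK.
Qed.

Local Notation E := (path_val vertex_elt edge_elt).

Definition path_elt (v w : V) (x : G) : Prop :=
  exists l p, [/\ composable v l w, supported w p & x = E l * vertex_elt w p].

Lemma path_elt_vertex v p : supported v p -> path_elt v v (vertex_elt v p).
Proof. by exists [::], p; rewrite mul1g. Qed.

Lemma path_elt_step a :
  path_elt (step_src a) (step_tgt a) (step_val edge_elt a).
Proof.
exists [:: (1, a)], 1; split; [split=> //;
  exact: supported1|exact: supported1|].
by rewrite /= (mor1 (vertex_elt (step_src a))) (mor1 (vertex_elt _)) mul1g
  !mulg1.
Qed.

Lemma path_elt_mul u v w x y :
  path_elt u v x -> path_elt v w y -> path_elt u w (x * y).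
Proof.
move=> [l [p [lc pv ->]]] [[|s m] [q [mc qw ->]]].
  move: mc qw => /= <- qv; exists l, (p * q); split=> //;
    first exact: supportedM.
  by rewrite mul1g gmulfM mulgA.
case: mc => sv iv mc; exists (l ++ (p * s.1, s.2) :: m), q; split=> //.
  by apply: composable_cat lc _; split=> //; apply: supportedM.
by rewrite path_val_cat /= sv gmulfM !mulgA.
Qed.

Lemma path_elt1 v : path_elt v v 1.
Proof. by exists [::], 1; rewrite (mor1 (vertex_elt v)) mul1g; split=> //;
  exact: supported1. Qed.

Lemma path_elt_walk x p y : walk x p y -> path_elt x y (walk_val edge_elt p).
Proof.
elim: p x => [|a p IHp] x /=; first by move/eqP->; apply: path_elt1.
by case/andP=> /eqP <- /IHp; apply: path_elt_mul; apply: path_elt_step.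
Qed.

Lemma tree_walk_val p : walk_in T p -> walk_val edge_elt p = 1.
Proof.
elim: p => // a p IHp Tp /=; rewrite IHp ?mulg1; last first.
  by move=> b bp; apply: Tp; rewrite inE bp orbT.
have te : edge_elt a.1 = 1.
  by apply/pclassP/word_eq_rel/pi1_rel_tree/Tp/mem_head.
by rewrite /step_val te invg1 if_same.
Qed.

Hypothesis Tconn : forall v w, exists p, walk v p w /\ walk_in T p.

(** Generators are brought to the base vertex along the tree, whose paths have
    value 1. *)
Lemma closed_path_elt r x : path_elt r r x.
Proof.
have to1 v w : path_elt v w 1.
  have [p [wp Tp]] := Tconn v w.
  by rewrite -(tree_walk_val Tp); apply: path_elt_walk.
have move_base v w y : path_elt v w y -> path_elt r r y.
  move=> vwy; rewrite -[y]mulg1 -[y]mul1g.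
  by apply: path_elt_mul (to1 w r); apply: path_elt_mul vwy.
elim/presented_ind: x => [|x y|[[[v g]|e] b]]; first exact: path_elt1.
- exact: path_elt_mul.
- have vg : path_elt v v (vertex_elt v (at_v v g)).
    by apply/path_elt_vertex/supported_inj_at.
  have vgV : path_elt v v (vertex_elt v (at_v v g^-1)).
    by apply/path_elt_vertex/supported_inj_at.
  case: b; last by apply: (move_base v v); move: vg;
    rewrite /vertex_elt inj_at_in.
  apply: (move_base v v); rewrite pclass_inv.
  have gV : vertex_elt v (at_v v g^-1) = (vertex_elt v (at_v v g))^-1.
    by rewrite (morV (@inj_at V (vertex_group GG) v));
      apply: (morV (vertex_elt v)).
  by move: vgV; rewrite gV /vertex_elt inj_at_in.
- case: b; last exact: move_base (path_elt_step (e, false)).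
  by rewrite pclass_inv; apply: move_base (path_elt_step (e, true)).
Qed.

(** No syllable, also not the first one after the last one, undoes the step
    before it. Words with a single syllable are always cyclically reduced. *)
Definition cyclically_reduced (l : path_word) : Prop :=
  forall i s1 s2 m, rot i l = [:: s1, s2 & m] ->
    s2.2 = rev_step s1.2 -> forall c : edge_group GG s2.2.1, s2.1 <> attach c.

Lemma rot_closed v l i : composable v l v ->
  exists2 w, composable w (rot i l) w &
  conjugate_elts (E l) (E (rot i l)).
Proof.
rewrite -{1}(cat_take_drop i l) => /composable_catE[w lw lv].
exists w; first exact: composable_cat lv lw.
exists (E (take i l)); rewrite /rot -{1}(cat_take_drop i l) !path_val_cat.
by rewrite conjgE -mulgA mulKg.
Qed.

(** As long as a closed path backtracks somewhere, rotate it so that it does so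
    at its beginning and remove the two steps; the length drops. *)
Lemma cyclic_normal_form (r : V) x :
  (exists v p, supported v p /\ conjugate_elts x (vertex_elt v p)) \/
  (exists v l, [/\ composable v l v, l <> [::], cyclically_reduced l &
     conjugate_elts x (E l)]).
Proof.
have [l [p [lc pr xE]]] := closed_path_elt r x.
have {xE} : conjugate_elts x (E l * vertex_elt r p) by exists 1; rewrite conjg1.
have [n] := ubnP (size l); elim: n => // n IHn in r l p lc pr *.
rewrite ltnS => le_ln xE; case: l lc le_ln xE => [|[g a] l] lc le_ln xE.
  by left; exists r, p; split=> //; rewrite mul1g in xE.
(* The trailing vertex element is absorbed by the first syllable. *)
set l' := (p * g, a) :: l.
have lc' : composable r l' r by case: lc => *; split=> //; apply: supportedM.
have {}xE : conjugate_elts x (E l').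
  apply: conjugate_elts_trans xE _; exists (vertex_elt r p)^-1.
  case: lc => /= -> _ _; rewrite conjgE invgK gmulfM -!mulgA mulgV mulg1.
  by rewrite !mulgA.
have {le_ln} sz : size l' <= n by [].
have [red|] := pselect (cyclically_reduced l'); first by right; exists r, l'.
rewrite /cyclically_reduced => /existsNP[i] /existsNP[[g1 a1]].
move=> /existsNP[[g2 a2]] /existsNP[m] /not_implyP[em] /not_implyP[/= ea].
move=> /existsNP[c /contrapT eg].
have [w wc cl] := rot_closed i lc'.
have {cl}xE := conjugate_elts_trans xE cl.
move: wc xE; rewrite em => -[/= s1 i1 [/= s2 i2 mc]] xE.
subst a2; rewrite tgt_rev s1 in mc.
have {}sz : size m < n.
  by have := congr1 size em; rewrite size_rot /=; move: sz => /=; lia.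
apply: (IHn w m (g1 * @attach a1 c) mc _ sz).
  by apply: supportedM; rewrite // -s1; apply: supported_attach.
have eg1 : E ((g1, a1) :: (g2, rev_step a1) :: m) =
    vertex_elt w (g1 * @attach a1 c) * E m.
  rewrite /= s1 gmulfM -mulgA; congr (_ * _).
  rewrite src_rev eg step_val_rev.
  have := @step_relation a1 c.
  by rewrite s1 => e; rewrite !mulgA -e mulgK.
have {}xE : conjugate_elts x (vertex_elt w (g1 * @attach a1 c) * E m).
  by rewrite -eg1; exact: xE.
apply: conjugate_elts_trans xE _; exists (vertex_elt w (g1 * @attach a1 c)).
by rewrite conjgE mulgA mulKg.
Qed.
End PathWords.

(** * Homomorphisms to finite groups *)

Lemma walk_val_rev (Gamma : graph) (L : groupType) (tau : edge Gamma -> L) p :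
  walk_val tau (rev (map (@rev_step Gamma) p)) = (walk_val tau p)^-1.
Proof.
elim: p => [|a p IHp]; first by rewrite /= invg1.
by rewrite /= rev_cons -cats1 walk_val_cat IHp /= mulg1 step_val_rev invgM.
Qed.

Section Representations.
Variables (Gamma : graph) (GG : graph_of_groups Gamma) (T : subgraph Gamma).
Local Notation V := (vertex Gamma).
Local Notation P := (prodgroup (vertex_group GG)).
Local Notation at_v v x := (@inj_at V (vertex_group GG) v x).
Local Notation G := (pi1 GG T).
Local Notation E := (path_val (vertex_elt T) (edge_elt GG T)).

Hypothesis Tconn : forall v w, exists p, walk v p w /\ walk_in T p.
Hypothesis Tnc : forall p, walk_in T p -> ~ circuit p.
Variable r : V.

Variables (L : finGroupType) (phi : {multiplicative P -> L}).
Variable tau : edge Gamma -> L.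
Hypothesis compat : forall (e : edge Gamma) (c : edge_group GG e),
  phi (@attach _ GG (e, false) c) * tau e =
  tau e * phi (@attach _ GG (e, true) c).
Variable A : {group L}.
Hypotheses (phiA : forall p, phi p \in A) (tauA : forall e, tau e \in A).

Let tree_path v := sval (cid (Tconn r v)).
Let Gam v : L := walk_val tau (tree_path v).

Let step_valA a : step_val tau a \in A.
Proof. by rewrite /step_val; case: a.2; rewrite ?groupV. Qed.

Let GamA v : Gam v \in A.
Proof.
by rewrite /Gam; elim: (tree_path v) => [|a p IHp] /=; rewrite ?group1 ?groupM.
Qed.

Definition gen_image (x : pi1_gen GG) : L :=
  match x with
  | inl s => phi (at_v (tag s) (tagged s)) ^ (Gam (tag s))^-1
  | inr e => Gam (d0 e) * tau e * (Gam (d1 e))^-1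
  end.

Lemma gen_imageP : respects_relations (pi1_rel T) gen_image.
Proof.
move=> _ _ [v x y|e Te|e c]; rewrite /= /letter_val /= !mulg1.
- by rewrite -conjMg -gmulfM -inj_atM.
- have [w0 T0] := svalP (cid (Tconn r (d0 e))).
  have [w1 T1] := svalP (cid (Tconn r (d1 e))).
  set p0 := sval _ in w0 T0; set p1 := sval _ in w1 T1.
  have := circuitless_walk_val tau Tnc (x := r)
    (p := p0 ++ (e, false) :: rev (map (@rev_step Gamma) p1)).
  rewrite walk_val_cat /= walk_val_rev mulgA; apply.
    move=> a; rewrite mem_cat inE mem_rev =>
      /or3P[/T0|/eqP->|/mapP[b /T1 Tb ->]] //.
  by apply: walk_trans w0 _; rewrite /= eqxx; apply: walk_rev.
- have := @compat e c; rewrite /attach /step_val /= => ec.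
  rewrite !conjgE !invgK !invgM !invgK !mulgA !mulgVK.
  by rewrite -(mulgA _ (tau e)) -ec !mulgA mulgK.
Qed.

(** The vertex group at [v] and the edge [e] are sent to their images in [L]
    conjugated, on either side, by the values [Gam] of tree paths from the base
    [r]. An edge of the tree closes up two such paths to a closed walk in the
    tree, hence goes to 1. *)
Lemma representation : exists (h : {multiplicative G -> L}) (Gamma0 : V -> L),
  [/\ forall v, Gamma0 v \in A, forall g, h g \in A &
   forall v l w p, composable v l w -> supported w p ->
     h (E l * vertex_elt T w p) =
       Gamma0 v * (path_val (fun=> phi) tau l * phi p) * (Gamma0 w)^-1].
Proof.
pose h : {multiplicative G -> L} := presented_lift gen_imageP.
have hw w : h (pclass (pi1_rel T) w) = word_val gen_image w.
  exact: presented_liftE.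
exists h, Gam; split=> [//|g|].
  elim/presented_ind: g => [|x y Ax Ay|a]; rewrite ?mor1 ?gmulfM ?groupM //.
  rewrite hw /= mulg1 /letter_val.
  have gA : gen_image a.1 \in A.
    by case: a.1 => [s|e] /=; rewrite ?groupJ ?groupM ?groupV.
  by case: a.2; rewrite ?groupV.
have hV w p : supported w p -> h (vertex_elt T w p) =
  Gam w * phi p * (Gam w)^-1.
  by move=> pw; rewrite hw /= mulg1 /letter_val /= -pw conjgE invgK mulgA.
have hE a : h (step_val (edge_elt GG T) a) =
    Gam (step_src a) * step_val tau a * (Gam (step_tgt a))^-1.
  have he e : h (edge_elt GG T e) = Gam (d0 e) * tau e * (Gam (d1 e))^-1.
    by rewrite hw /= mulg1.
  rewrite /step_val /step_src /step_tgt; case: a.2; last exact: he.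
  by rewrite morV he !invgM invgK mulgA.
move=> v l w p; elim: l v => [|[g a] l IHl] v /=.
  by move=> -> pw; rewrite !mul1g hV.
move=> [sa gv lc] pw; rewrite -!mulgA !gmulfM hE -gmulfM (IHl _ lc pw) sa hV //.
by rewrite -!mulgA mulKg mulKg !mulgA.
Qed.

End Representations.

Section SeparationCriterion.
Variables (Gamma : graph) (GG : graph_of_groups Gamma) (T : subgraph Gamma).
Local Notation V := (vertex Gamma).
Local Notation P := (prodgroup (vertex_group GG)).
Local Notation G := (pi1 GG T).
Local Notation E := (path_val (vertex_elt T) (edge_elt GG T)).

Hypothesis Tconn : forall v w, exists p, walk v p w /\ walk_in T p.
Hypothesis Tnc : forall p, walk_in T p -> ~ circuit p.

(** On closed paths the homomorphism of [representation] differs from the naive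
    evaluation in [L] by conjugation with an element of [A] only. The subgroup
    [A] contains the image of the fundamental group; in the applications it is
    the centralizer of a permutation. *)
Lemma separation_criterion (L : finGroupType) (phi : {multiplicative P -> L})
    (tau : edge Gamma -> L) (A : {group L}) (x y : G) v l p w m q :
  (forall (e : edge Gamma) (c : edge_group GG e),
    phi (@attach _ GG (e, false) c) * tau e =
    tau e * phi (@attach _ GG (e, true) c)) ->
  (forall p, phi p \in A) -> (forall e, tau e \in A) ->
  composable v l v -> supported v p ->
    conjugate_elts x (E l * vertex_elt T v p) ->
  composable w m w -> supported w q ->
    conjugate_elts y (E m * vertex_elt T w q) ->
  (forall g, g \in A -> (path_val (fun=> phi) tau l * phi p) ^ g <>
     path_val (fun=> phi) tau m * phi q) ->
  finitely_separated x y.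
Proof.
move=> compat phiA tauA lc pv [g xg] mc qw [g' yg] sep.
have [h [Gam [GamA hA hE]]] := representation Tconn Tnc v compat phiA tauA.
exists L, h => k hk.
have := hE _ _ _ _ lc pv; rewrite -xg morJ => ex.
have := hE _ _ _ _ mc qw; rewrite -yg morJ => ey.
apply: (sep ((Gam v)^-1 * (h g)^-1 * h k * h g' * Gam w)).
  by rewrite !groupM ?groupV.
have -> : path_val (fun=> phi) tau m * phi q =
    (h y ^ h g') ^ Gam w by rewrite ey conjgE -!mulgA mulKg mulVg mulg1.
have -> : path_val (fun=> phi) tau l * phi p =
    (h x ^ h g) ^ Gam v by rewrite ex conjgE -!mulgA mulKg mulVg mulg1.
by rewrite -hk -!conjgM !mulgA mulgK mulgV mul1g.
Qed.
End SeparationCriterion.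

(** * Elements of the vertex groups *)

Lemma finite_enum (I : choiceType) : finite_set [set: I]%classic ->
  exists s : seq I, forall x, x \in s.
Proof.
move=> /finite_seqP[s e]; exists s => x.
by have : [set: I]%classic x by []; rewrite e.
Qed.

Section PullbackActions.
Variables (gT hT : finGroupType) (X : finType) (act : {action gT &-> X}).
Variable f : {morphism [set: hT] >-> gT}.

Definition pull_fun (x : X) (k : hT) : X := act x (f k).
Lemma pull_fun1 : pull_fun^~ 1 =1 id.
Proof. by move=> x; rewrite /pull_fun morph1 act1. Qed.
Lemma pull_funM x : act_morph pull_fun x.
Proof. by move=> k l; rewrite /pull_fun morphM ?inE // actM. Qed.
Definition pull_act := TotalAction pull_fun1 pull_funM.

Lemma fix_pull (H : {group hT}) : 'Fix_pull_act(H) = 'Fix_act(f @* H).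
Proof.
apply/setP=> x; apply/afixP/afixP => fx.
  by move=> _ /morphimP[k _ kH ->]; apply: fx.
by move=> k kH; apply: fx; apply: mem_morphim; rewrite ?inE.
Qed.
End PullbackActions.

(** A finite group [Q] with partial identifications [Delta i] between subgroups,
    and a set [D0] of elements closed under conjugation and identification: [Q]
    maps to a finite group in which the identifications are induced by
    conjugation, yet no element of [D0] becomes conjugate, by elements
    commuting with a certain transformation, to an element outside.

    The cyclic factor [Z] makes elements visible to the table of marks, which
    only sees subgroups: the subgroup generated by [(g, a)] determines [g]. *)
Section Fusion.
Variables (Q : finGroupType) (I : Type) (Delta : I -> {group Q * Q}).
Hypothesis inj1 : forall i, {in Delta i &, injective fst}.
Hypothesis inj2 : forall i, {in Delta i &, injective snd}.
Variable D0 : pred Q.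
Hypothesis D0J : forall x g, D0 (x ^ g) = D0 x.
Hypothesis D0fusion : forall i k, k \in Delta i -> D0 k.1 = D0 k.2.

(* A cyclic group of order [#|Q|], a multiple of the order of every element. *)
Let Z : finGroupType := 'I_(#|Q|.-1.+1).
Let a : Z := Zp1.
Let Q' : finGroupType := (Q * Z)%type.
Let hT : finGroupType := (Q * Q * Z)%type.

Let expg_card (x : Q) : x ^+ #[a] = 1.
Proof.
rewrite order_Zp1 prednK; last by apply/card_gt0P; exists 1.
by rewrite -cardsT expg_cardG ?inE.
Qed.

Definition pr1_fun (k : hT) : Q' := (k.1.1, k.2).
Definition pr2_fun (k : hT) : Q' := (k.1.2, k.2).
Lemma pr1_funM : {morph pr1_fun : x y / x * y}. Proof. by []. Qed.
Lemma pr2_funM : {morph pr2_fun : x y / x * y}. Proof. by []. Qed.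
Definition pr1 := @Morphism _ _ [set: hT] pr1_fun (in2W pr1_funM).
Definition pr2 := @Morphism _ _ [set: hT] pr2_fun (in2W pr2_funM).

Let D (H : {group Q'}) := [exists g, D0 g && (gval H == <[(g, a) : Q']>)].

Let D_cycle g : D <[(g, a) : Q']>%G = D0 g.
Proof.
apply/existsP/idP => [[h /andP[Dh /eqP e]]|Dg]; last by exists g;
  rewrite Dg eqxx.
have /cycleP[j] : (g, a) \in <[(h, a) : Q']> by rewrite -e cycle_id.
have expE m : ((h, a) : Q') ^+ m = (h ^+ m, a ^+ m).
  by elim: m => // m IHm; rewrite !expgS IHm.
rewrite expE => -[eg ea].
have dh : #[h] %| #[a] by rewrite order_dvdn expg_card.
have : a ^+ j == a ^+ 1 by rewrite -ea expg1.
rewrite eq_expg_mod_order => /eqP ja.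
suff -> : g = h ^+ 1 by rewrite expg1.
by apply/eqP; rewrite eg eq_expg_mod_order -(modn_dvdm j dh) ja modn_dvdm.
Qed.

Let DJ (H : {group Q'}) (g : Q') : D (H :^ g)%G = D H.
Proof.
have aJ (z : Z) : a ^ z = a.
  by rewrite conjgE Zp_mulgC -mulgA mulgV mulg1.
have oneway (H' : {group Q'}) (g' : Q') : D H' -> D (H' :^ g')%G.
  move=> /existsP[h /andP[Dh /eqP e]]; apply/existsP; exists (h ^ g'.1).
  rewrite D0J Dh /= e -cycleJ; apply/eqP; congr (<[_]>).
  congr (_, _); exact: aJ.
apply/idP/idP; last exact: oneway.
move/(oneway _ g^-1); congr (is_true (D _)); apply: val_inj => /=.
by rewrite conjsgK.
Qed.

Let K i := setX_group (Delta i) [set: Z]%G.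

Let memK i k : k \in K i -> k.1 \in Delta i.
Proof. by case: k => k z /setXP[]. Qed.

Let injK1 i : {in K i &, injective pr1_fun}.
Proof.
move=> [k z] [k' z'] /setXP[kD _] /setXP[kD' _] [e ->].
by rewrite (inj1 kD kD' e).
Qed.

Let injK2 i : {in K i &, injective pr2_fun}.
Proof.
move=> [k z] [k' z'] /setXP[kD _] /setXP[kD' _] [e ->].
by rewrite (inj2 kD kD' e).
Qed.

(** A group of pairs one projection of which is generated by some [(g, a)] is
    itself generated by the corresponding pair. *)
Let fused_cycle i (H : {group hT}) (f f' : {morphism [set: hT] >-> Q'}) g :
  H \subset K i -> {in K i &, injective f} -> {in K i &, injective f'} ->
  f @* H = <[(g, a) : Q']> ->
  exists2 k, k \in K i & f k = (g, a) /\ f' @* H = <[f' k]>.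
Proof.
move=> sHK injf injf' e.
have : ((g, a) : Q') \in f @* H by rewrite e cycle_id.
move=> /morphimP[k _ kH ek].
have kK := fintype.subsetP sHK k kH; exists k => //; split=> //.
rewrite -(morphim_cycle f') ?inE //; congr (_ @* _).
apply/esym/eqP; rewrite eqEcard cycle_subG kH /=.
rewrite -(card_in_imset (sub_in2 (fintype.subsetP sHK) injf)) -morphimEsub
  ?finset.subsetT //.
rewrite e ek -morphim_cycle ?inE // morphimEsub ?finset.subsetT //;
  exact: leq_imset_card.
Qed.

Let same_D i (H : {group hT}) : H \subset K i ->
  D (pr1 @* H)%G = D (pr2 @* H)%G.
Proof.
move=> sHK; apply/existsP/existsP => -[g /andP[Dg /eqP e]].
  have [k kK [/= [ek1 ek2] ->]] :=
    fused_cycle (f := pr1) (f' := pr2) sHK (@injK1 i) (@injK2 i) e.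
  exists k.1.2; have kD := memK kK; rewrite -(D0fusion kD) ek1 Dg.
  by apply/eqP; rewrite /pr2_fun ek2.
have [k kK [/= [ek1 ek2] ->]] :=
  fused_cycle (f := pr2) (f' := pr1) sHK (@injK2 i) (@injK1 i) e.
exists k.1.1; have kD := memK kK; rewrite (D0fusion kD) ek1 Dg.
by apply/eqP; rewrite /pr1_fun ek2.
Qed.

Let card_pr i (H : {group hT}) (f : {morphism [set: hT] >-> Q'}) :
  H \subset K i -> {in K i &, injective f} -> #|f @* H| = #|H|.
Proof.
move=> sHK injf; rewrite morphimEsub ?finset.subsetT //.
exact: card_in_imset (sub_in2 (fintype.subsetP sHK) injf).
Qed.

(** Here [Q * Z] acts on a set whose marks distinguish the subgroups generated
    by [(g, a)] with [g] in [D0] by the parity of a multiplicity; the marks of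
    the two projections of any subgroup of the identifications agree, so these
    are induced by permutations. A permutation [g] that conjugates [x] to [y]
    and commutes with [(1, a)] conjugates [(x, a)] to [(y, a)], and these then
    have equally many fixed points. *)
Lemma fusion_separation : exists (L : finGroupType)
    (phi : {multiplicative Q -> L}) (tau : I -> L) (A : {group L}),
  [/\ forall i k, k \in Delta i -> phi k.1 * tau i = tau i * phi k.2,
      forall x, phi x \in A, forall i, tau i \in A &
      forall x y g, g \in A -> D0 x -> phi x ^ g = phi y -> D0 y].
Proof.
have [X [act [T [J marks]]]] := prescribed_marks DJ.
have phiM : {morph (fun x : Q => actperm act ((x, 1) : Q')) : x y / x * y}.
  move=> x y; rewrite -actpermM ?inE //; congr (actperm act _).
  by congr (_, _); rewrite mulg1.
have same i (H : {group hT}) : H \subset K i ->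
    #|'Fix_(pull_act act pr1)(H)| = #|'Fix_(pull_act act pr2)(H)|.
  move=> sHK; rewrite !fix_pull.
  rewrite (marks (pr1 @* H)%G) (marks (pr2 @* H)%G) (same_D sHK) /=.
  rewrite (card_pr (f := pr1) sHK (@injK1 i)).
  by rewrite (card_pr (f := pr2) sHK (@injK2 i)).
have nomatch i :
    matching (pull_act act pr1) (pull_act act pr2) (K i) finset.set0.
  by split=> [x y k _|x y y'|x x' y]; rewrite inE.
pose tau i : {perm X} :=
  sval (cid (equivariant_extension (@same i) (nomatch i))).
have tauP i k x : k \in K i -> tau i (act x (pr1 k)) = act (tau i x) (pr2 k).
  move: x k.
  by have [_] := svalP (cid (equivariant_extension (@same i) (nomatch i))).
pose delta := actperm act ((1, a) : Q').
have phi_delta x : as_mor phiM x * delta = actperm act ((x, a) : Q').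
  rewrite -actpermM ?inE //; congr (actperm act _); congr (_, _).
    by rewrite mulg1.
  by rewrite mul1g.
exists {perm X}, (as_mor phiM), tau, 'C[delta]%G; split.
- move=> i k kD; apply/permP=> x; rewrite !permM !actpermE.
  by apply: (@tauP i (k, 1)); rewrite inE /= kD inE.
- move=> x; apply/cent1P; rewrite /commute phi_delta -actpermM ?inE //.
  by congr (actperm act _); congr (_, _); rewrite ?mul1g ?mulg1.
- move=> i; apply/cent1P/permP=> x; rewrite !permM !actpermE.
  by rewrite -(@tauP i ((1, 1), a)) // inE /= group1 inE.
move=> x y g /cent1P gd Dx exy.
have fixE h : #|'Fix_act(<[(h, a) : Q']>)| =
    #|[set p | (as_mor phiM h * delta) p == p]|.
  apply: eq_card => p; rewrite afix_cycle [RHS]inE phi_delta.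
  by apply/afix1P/eqP; rewrite actpermE.
have e : (as_mor phiM x * delta) ^ g = as_mor phiM y * delta.
  by rewrite conjMg exy; congr (_ * _); rewrite conjgE -gd mulKg.
have : #|'Fix_act(<[(x, a) : Q']>)| = #|'Fix_act(<[(y, a) : Q']>)|.
  rewrite !fixE -e -(card_imset _ (@perm_inj _ g)); apply: eq_card => p.
  rewrite inE; apply/imsetP/eqP => [[q]|ep].
    by rewrite inE => /eqP eq ->; rewrite permJ eq.
  exists (g^-1 p); last by rewrite permKV.
  rewrite inE; apply/eqP/(@perm_inj _ g).
  by rewrite -permJ permKV ep.
rewrite (marks <[(x, a) : Q']>%G) (marks <[(y, a) : Q']>%G) /= !D_cycle Dx.
move=> /addIn/eqP; rewrite eqn_pmul2l; last by apply/card_gt0P; exists 1;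
  rewrite inE.
by case: (D0 y) => // /eqP; lia.
Qed.
End Fusion.

Lemma conjugate_elts_refl (G : groupType) (x : G) : conjugate_elts x x.
Proof. by exists 1; rewrite conjg1. Qed.

Section AttachedFinite.
Variables (Gamma : graph) (GG : graph_of_groups Gamma).
Local Notation V := (vertex Gamma).
Local Notation P := (prodgroup (vertex_group GG)).

Hypothesis edges_finite : finite_set [set: edge Gamma]%classic.
Hypothesis edge_groups_finite :
  forall e : edge Gamma, finite_set [set: edge_group GG e]%classic.

Lemma enum_steps (B : eqType)
    (F : forall a : step Gamma, edge_group GG a.1 -> B) :
  exists s : seq B, forall a c, F a c \in s.
Proof.
have [es esP] := finite_enum edges_finite.
pose cs e := sval (cid (finite_enum (edge_groups_finite e))).
have csP e c : c \in cs e.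
  exact: (svalP (cid (finite_enum (edge_groups_finite e))) c).
exists (flatten [seq [seq F (e, b) c | c <- cs e] | e <- es, b <- [:: true;
  false]]).
move=> [e b] c; apply/flattenP; exists [seq F (e, b) c | c <- cs e].
  apply/allpairsP; exists (e, b); split=> //=.
  by case: b {c}; rewrite !inE.
exact: (map_f (F (e, b)) (csP e c)).
Qed.

(** The identifications made by the edge [e] in a quotient of the product of
    the vertex groups. *)
Section EdgePairs.
Variables (Q : finGroupType) (f : {multiplicative P -> Q}) (e : edge Gamma).

Definition edge_pairs : {set Q * Q} := [set k | `[< exists c : edge_group GG e,
  k = (f (@attach _ GG (e, false) c), f (@attach _ GG (e, true) c)) >]].

Lemma edge_pairsP k : k \in edge_pairs <-> exists c : edge_group GG e,
  k = (f (@attach _ GG (e, false) c), f (@attach _ GG (e, true) c)).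
Proof. by rewrite /edge_pairs inE; split=> /asboolP. Qed.

Lemma edge_pairs_group_set : group_set edge_pairs.
Proof.
apply/group_setP; split=> [|k l].
  by apply/edge_pairsP; exists 1; rewrite !(mor1 (@attach _ GG _)) !mor1.
move=> /edge_pairsP[c ->] /edge_pairsP[d ->]; apply/edge_pairsP; exists (c * d).
by rewrite !gmulfM.
Qed.
Canonical edge_pairs_group := Group edge_pairs_group_set.

Lemma edge_pairs_inj1 : injective (f \o @attach _ GG (e, false)) ->
  {in edge_pairs &, injective fst}.
Proof. by move=> fi k l /edge_pairsP[c ->] /edge_pairsP[d ->] /fi ->. Qed.

Lemma edge_pairs_inj2 : injective (f \o @attach _ GG (e, true)) ->
  {in edge_pairs &, injective snd}.
Proof. by move=> fi k l /edge_pairsP[c ->] /edge_pairsP[d ->] /fi ->. Qed.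
End EdgePairs.

Variable T : subgraph Gamma.
Local Notation G := (pi1 GG T).
Local Notation E := (path_val (vertex_elt T) (edge_elt GG T)).
Local Notation J := (@vertex_elt _ GG T).

Hypothesis Tconn : forall v w, exists p, walk v p w /\ walk_in T p.
Hypothesis Tnc : forall p, walk_in T p -> ~ circuit p.
Hypothesis csP : conjugacy_separable P.

(** Elements at different vertices are conjugate in the product only if they are
    trivial. *)
Lemma conjugate_vertex_elt v w p q : supported v p -> supported w q ->
  conjugate_elts p q ->
  conjugate_elts (J v p) (J w q).
Proof.
move=> pv qw pq; have coord_conj u : conjugate_elts (p u) (q u).
  by have [g <-] := pq; exists (g u).
have [evw|nvw] := eqVneq v w.
  subst w; have [g eg] := coord_conj v; exists (J v (inj_at g)).
  rewrite -(morJ (@vertex_elt _ GG T v)); congr (pclass _ (vgen _)).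
  by rewrite -eg -[in RHS](inj_at_in g).
have p1 : p v = 1.
  have := coord_conj v; rewrite qw inj_at_out 1?eq_sym // => -[g].
  by move/eqP; rewrite conjg_eq1 => /eqP.
have q1 : q w = 1.
  by have := coord_conj w; rewrite pv inj_at_out // => -[g <-]; rewrite conj1g.
exists 1; rewrite conjg1.
have -> : p = 1 by rewrite pv p1 (mor1 (@inj_at _ (vertex_group GG) v)).
have -> : q = 1 by rewrite qw q1 (mor1 (@inj_at _ (vertex_group GG) w)).
by rewrite (mor1 (J v)) (mor1 (J w)).
Qed.

Lemma conjugate_att a c :
  conjugate_elts (J (step_src a) (@attach _ GG a c)) (J (step_tgt a) (@attach _
    GG (rev_step a) c)).
Proof.
exists (step_val (edge_elt GG T) a); rewrite conjgE step_relation mulKg //.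
Qed.

(** In a quotient [Q] that separates the conjugacy classes of [p], [q] and the
    edge groups, [D0] collects the elements conjugate to the image of one of
    these elements that is conjugate to [x]. It contains the image of [p], is
    closed under the edge identifications, and would make [y] conjugate to [x]
    if it contained the image of [q]. *)
Lemma elliptic_separation x y v p w q :
  supported v p -> conjugate_elts x (J v p) -> supported w q ->
    conjugate_elts y (J w q) ->
  ~ conjugate_elts x y -> finitely_separated x y.
Proof.
move=> pv xp qw yq nxy.
have [s0 s0P] := enum_steps (fun a c => (step_src a, @attach _ GG a c)).
pose s := [:: (v, p), (w, q) & s0].
have att_s a c : (step_src a, @attach _ GG a c) \in s by rewrite !inE s0P !orbT.
have [Q [f fP]] := separate_conjugates (map snd s) csP.
have f_att a : injective (f \o @attach _ GG a).
  move=> c d /= ecd; have [|||g] :=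
    fP (@attach _ GG a (c * d^-1)) (@attach _ GG a 1).
  - by apply: (map_f snd (att_s a _)).
  - by apply: (map_f snd (att_s a _)).
  - exists 1; rewrite conjg1 !gmulfM !(mor1 (@attach _ GG _)) !mor1.
    by rewrite (morV (@attach _ GG _)) morV ecd mulgV.
  rewrite (mor1 (@attach _ GG _)) => /eqP;
    rewrite conjg_eq1 -(mor1 (@attach _ GG a)).
  by rewrite (inj_eq (@attach_inj _ GG a)) => /eqP/divg1_eq.
pose D0 g := `[< exists s1, [/\ s1 \in s, supported s1.1 s1.2,
   conjugate_elts x (J s1.1 s1.2) & conjugate_elts (f s1.2) g] >].
have D0J g h : D0 (g ^ h) = D0 g.
  apply/asboolP/asboolP => -[s1 [s1s s1v xs1 fs1]]; exists s1; split=> //.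
    by apply: conjugate_elts_trans fs1 _; exists h^-1; rewrite conjgK.
  by apply: conjugate_elts_trans fs1 _; exists h.
have D0_att a c : D0 (f (@attach _ GG a c)) ->
  D0 (f (@attach _ GG (rev_step a) c)).
  move=> /asboolP[s1 [s1s s1v xs1 fs1]]; apply/asboolP.
  exists (step_tgt a, @attach _ GG (rev_step a) c).
  rewrite -src_rev; split; rewrite ?att_s //; first exact: supported_attach.
    rewrite src_rev /=; apply: (@conjugate_elts_trans _ (J (step_src a) (@attach
      _ GG a c))); last exact: conjugate_att.
    apply: conjugate_elts_trans xs1 _.
    apply: conjugate_vertex_elt s1v (supported_attach c) _.
    by apply: fP fs1; [exact: map_f | apply: (map_f snd (att_s a _))].
  exact: conjugate_elts_refl.
have D0fusion e k : k \in edge_pairs_group f e -> D0 k.1 = D0 k.2.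
  move=> /edge_pairsP[c ->] /=; apply/idP/idP;
    first exact: (@D0_att (e, false)).
  exact: (@D0_att (e, true)).
have [L [phi [tau [A [compat phiA tauA sep]]]]] := fusion_separation
  (fun e => edge_pairs_inj1 (@f_att (e, false)))
  (fun e => edge_pairs_inj2 (@f_att (e, true))) D0J D0fusion.
have fcompat e c : (phi \o f) (@attach _ GG (e, false) c) * tau e =
    tau e * (phi \o f) (@attach _ GG (e, true) c).
  apply: (compat e (f (@attach _ GG (e, false) c), f (@attach _ GG (e,
    true) c))).
  by apply/edge_pairsP; exists c.
apply: (separation_criterion Tconn Tnc (l := [::]) (m := [::]) fcompat _ tauA
  (erefl v) pv _ (erefl w) qw) => [p'|||g gA].
- exact: phiA.
- by rewrite mul1g.
- by rewrite mul1g.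
rewrite /= !mul1g => /(sep _ _ _ gA) Dq.
have /asboolP[s1 [s1s s1v xs1 fs1]] : D0 (f q).
  apply: Dq; apply/asboolP; exists (v, p); split=> //;
    first by rewrite inE eqxx.
  exact: conjugate_elts_refl.
apply: nxy; apply: conjugate_elts_trans xs1 _.
apply: (conjugate_elts_trans _ (conjugate_elts_sym yq)).
apply: conjugate_vertex_elt s1v qw _.
by apply: fP fs1; [exact: map_f | rewrite !inE eqxx orbT].
Qed.

End AttachedFinite.

(** * Integer powers *)

Section IntegerPowers.
Variables (G : groupType) (x : G).

Definition zpow (n : int) : G :=
  match n with Posz n => x ^+ n | Negz n => x ^- n.+1 end.

Lemma zpow_succ n : zpow (n + 1)%R = zpow n * x.
Proof.
case: n => [n|[|n]].
- by rewrite (_ : (_ + _)%R = Posz n.+1); [rewrite /= expgSr|lia].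
- by rewrite (_ : (_ + _)%R = Posz 0); [rewrite /= expg1 mulVg|lia].
rewrite (_ : (_ + _)%R = Negz n); last by lia.
by rewrite /= (expgS x n.+1) invgM mulgVK.
Qed.

Lemma zpow_pred n : zpow (n - 1)%R = zpow n * x^-1.
Proof.
have := zpow_succ (n - 1)%R; rewrite (_ : (_ - 1 + 1)%R = n); last by lia.
by move=> ->; rewrite mulgK.
Qed.

Lemma zpowD m n : zpow (m + n)%R = zpow m * zpow n.
Proof.
case: n => n; elim: n => [|n IHn].
- by rewrite (_ : (m + 0)%R = m) ?mulg1 //; lia.
- rewrite (_ : (m + Posz n.+1)%R = (m + Posz n + 1)%R); last by lia.
  by rewrite zpow_succ IHn /= expgSr mulgA.
- by rewrite (_ : (m + Negz 0)%R = (m - 1)%R) ?zpow_pred //; lia.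
rewrite (_ : (m + Negz n.+1)%R = (m + Negz n - 1)%R); last by lia.
by rewrite zpow_pred IHn -mulgA; congr (_ * _); rewrite -zpow_pred; congr zpow;
  lia.
Qed.

Lemma zpowN n : zpow (- n)%R = (zpow n)^-1.
Proof.
apply: (@mulgI _ (zpow n)); rewrite -zpowD mulgV.
by rewrite (_ : (_ + _)%R = 0%R) //; lia.
Qed.
End IntegerPowers.

Lemma zpow_eq_gen (gT : finGroupType) (a : gT) (n : int) :
  zpow a n = a -> (`|n - 1|%N < #[a])%N -> n = 1%R.
Proof.
move=> an; have : zpow a (n - 1)%R = 1 by rewrite zpow_pred an mulgV.
have dvd1 m : a ^+ m = 1 -> (m < #[a])%N -> m = 0%N.
  case: m => // m /eqP; rewrite -order_dvdn => /(dvdn_leq (ltn0Sn m)).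
  by rewrite leqNgt => /negbTE->.
case e : (n - 1)%R => [m|m] /=; first by move/dvd1=> H /H; lia.
by move/eqP; rewrite invg_eq1 => /eqP/dvd1 H /H; lia.
Qed.

(** * Partial actions labelled by group elements *)

Section LinkSystems.
Variables (Gamma : graph) (GG : graph_of_groups Gamma) (T : subgraph Gamma).
Local Notation V := (vertex Gamma).
Local Notation P := (prodgroup (vertex_group GG)).
Local Notation G := (pi1 GG T).
Local Notation E := (path_val (vertex_elt T) (edge_elt GG T)).
Local Notation J := (@vertex_elt _ GG T).
Local Notation t := (step_val (edge_elt GG T)).
Local Notation attached a c := (@attach Gamma GG a c).

(** The point [(i, p)] is the element [p] of the [i]-th copy of [P], on which
    [P] acts by right multiplication. A link [(e, y, z, w)] says that the edge
    [e] carries [y] to [z], and the translates of [y] by the edge group to those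
    of [z], while passing the number [w] of sheets of a cyclic cover. *)
Definition point := (nat * P)%type.
Definition link := (edge Gamma * point * point * int)%type.

Definition link_edge (k : link) : edge Gamma := k.1.1.1.
Definition link_end (k : link) (b : bool) : point :=
  if b then k.1.2 else k.1.1.2.
Definition link_weight (k : link) (b : bool) : int :=
  if b then (- k.2)%R else k.2.
Definition shift (y : point) (g : P) : point := (y.1, y.2 * g).

Definition link_point (k : link) (b : bool) (c : edge_group GG (link_edge k)) :
  point :=
  shift (link_end k b) (attached (link_edge k, b) c).

Variable x : G.

(** The copy [i] stands for the coset of elements [sys_label i * g], with [g] in
    the vertex group at [sys_vertex i]. *)
Record system := System {
  sys_size : nat;
  sys_links : seq link;
  sys_label : nat -> G;
  sys_vertex : nat -> V
}.

Definition point_label (S : system) (y : point) : G :=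
  sys_label S y.1 * J (sys_vertex S y.1) y.2.

(** Following a link multiplies the label by the edge, up to the power of [x] on
    the left that is recorded by the weight; different links of the same edge
    do not overlap, so the links define a partial injection. *)
Record consistent (S : system) : Prop := Consistent {
  cons_size : forall k b, k \in sys_links S ->
    ((link_end k b).1 < sys_size S)%N;
  cons_vertex : forall k b, k \in sys_links S ->
    sys_vertex S (link_end k b).1 = step_src (link_edge k, b);
  cons_label : forall k, k \in sys_links S ->
    point_label S (link_end k false) * edge_elt GG T (link_edge k) =
    zpow x k.2 * point_label S (link_end k true);
  cons_inj : forall k k' b c c', k \in sys_links S -> k' \in sys_links S ->
    link_edge k = link_edge k' ->
    @link_point k b c = @link_point k' b c' -> k = k'
}.

Definition moves (S : system) (a : step Gamma) (y z : point) (w : int) : Prop :=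
  exists k b (c : edge_group GG (link_edge k)), [/\ k \in sys_links S,
    a = (link_edge k, b), y = link_point b c, z = link_point (~~ b) c &
    w = link_weight k b].

Fixpoint runs (S : system) (y : point) (l : path_word GG) (z : point)
    (w : int) : Prop :=
  if l is s :: l' then exists y' w1 w2,
    [/\ moves S s.2 (shift y s.1) y' w1, runs S y' l' z w2 & w = (w1 + w2)%R]
  else y = z /\ w = 0%R.

Lemma link_point_label S k b c : consistent S -> k \in sys_links S ->
  point_label S (@link_point k b c) * t (link_edge k, b) =
  zpow x (link_weight k b) * point_label S (@link_point k (~~ b) c).
Proof.
move=> Sok kS.
have lab0 b' : point_label S (@link_point k b' c) =
    point_label S (link_end k b') * J (step_src (link_edge k,
      b')) (attached (link_edge k, b') c).
  rewrite /point_label /= (cons_vertex Sok b' kS).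
  by rewrite (gmulfM (s := @vertex_elt _ GG T _)) mulgA.
have labF : point_label S (@link_point k false c) * t (link_edge k, false) =
  zpow x (link_weight k false) * point_label S (@link_point k true c).
  rewrite !lab0 -mulgA step_relation mulgA (cons_label Sok kS).
  by rewrite -mulgA.
case: b; last exact: labF.
rewrite /= zpowN /step_val /=; apply: (@mulgI _ (zpow x k.2)).
rewrite mulVKg mulgA.
have : t (link_edge k, false) = edge_elt GG T (link_edge k) by [].
by move: labF => /= <- ->; rewrite mulgK.
Qed.

(** Labels are compared along a path: this is how a closed path with total
    weight 1 exhibits a conjugation to [x]. *)
Lemma runs_label S y l z w v : consistent S ->
  composable (sys_vertex S y.1) l v -> runs S y l z w ->
  point_label S y * E l = zpow x w * point_label S z /\ sys_vertex S z.1 = v.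
Proof.
move=> Sok; elim: l y w => [|[g a] l IHl] y w /=.
  by move=> yv [<- ->]; rewrite mulg1 mul1g.
move=> [sa ga lc] [y' [w1 [w2 [[k [b [c [kS ea ey ey' ew]]]] ry ->]]]].
have vy' : sys_vertex S y'.1 = step_tgt a.
  by rewrite ey' /= (cons_vertex Sok _ kS) ea -src_rev.
rewrite -vy' in lc; have [eE ev] := IHl _ _ lc ry; split=> //.
have key : point_label S y * J (step_src a) g * t a =
    zpow x w1 * point_label S y'.
  rewrite ew ea ey' -(link_point_label b c Sok kS) -ey; congr (_ * _).
  rewrite -ea sa /point_label /= (gmulfM (s := @vertex_elt _ GG T _)).
  exact/esym/mulgA.
by rewrite zpowD -[RHS]mulgA -eE (mulgA (zpow x w1)) -key -!mulgA.
Qed.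

(** Only links of weight 0 may be added, so the links of nonzero weight remain
    those of the original system. *)
Definition extends (S S' : system) : Prop :=
  [/\ (sys_size S <= sys_size S')%N,
      {subset sys_links S <= sys_links S'},
      forall k, k \in sys_links S' -> k \in sys_links S \/ k.2 = 0%R &
      forall i, (i < sys_size S)%N ->
        sys_label S' i = sys_label S i /\ sys_vertex S' i = sys_vertex S i].

Lemma extends_refl S : extends S S.
Proof. by split=> // k; left. Qed.

Lemma extends_trans S1 S2 S3 : extends S1 S2 -> extends S2 S3 -> extends S1 S3.
Proof.
move=> [le12 sub12 w12 lab12] [le23 sub23 w23 lab23]; split.
- exact: leq_trans le12 le23.
- by move=> k /sub12/sub23.
- by move=> k /w23[/w12|]; [|right].
by move=> i ilt; have [-> ->] := lab23 i (leq_trans ilt le12); apply: lab12.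
Qed.

Lemma moves_extends S S' a y z w : extends S S' -> moves S a y z w ->
  moves S' a y z w.
Proof. by move=> [_ sub _ _] [k [b [c [/sub kS e1 e2 e3 e4]]]];
  exists k, b, c. Qed.

Lemma runs_extends S S' l y z w : extends S S' -> runs S y l z w ->
  runs S' y l z w.
Proof.
move=> SS'; elim: l y w => //= s l IHl y w [y' [w1 [w2 [m r e]]]].
by exists y', w1, w2; split; [exact: moves_extends m|exact: IHl|].
Qed.

Lemma attach_transport e e' b (ee' : e = e') (c' : edge_group GG e') :
  exists c, attached (e', b) c' = attached (e, b) c.
Proof. by move: c'; rewrite -ee' => c; exists c. Qed.

(** Where no link leads on from [y] along [a], one to the neutral element of a
    fresh copy can be added; the label of that copy is forced. *)
Section NewLink.
Variables (S : system) (Sok : consistent S) (y : point) (a : step Gamma).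
Hypotheses (ylt : (y.1 < sys_size S)%N) (ya : step_src a = sys_vertex S y.1).
Hypothesis unlinked : ~ exists z w, moves S a y z w.

Let N := sys_size S.
Let fresh : point := (N, 1).
Let k0 : link := (a.1, if a.2 then fresh else y, if a.2 then y else fresh, 0%R).

Definition add_link : system := System N.+1 (k0 :: sys_links S)
  (fun i => if i == N then point_label S y * t a else sys_label S i)
  (fun i => if i == N then step_tgt a else sys_vertex S i).

Let k0_end b : link_end k0 b = if b == a.2 then y else fresh.
Proof. by rewrite /link_end /k0 /=; case: b; case: a.2. Qed.

Let fst_k0_end b : (link_end k0 b).1 = if b == a.2 then y.1 else N.
Proof. by rewrite k0_end; case: eqP. Qed.

Let old_label z : (z.1 < N)%N -> point_label add_link z = point_label S z.
Proof. by move=> zN; rewrite /point_label /= ltn_eqF. Qed.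

Let fresh_label : point_label add_link fresh = point_label S y * t a.
Proof. by rewrite /point_label /= eqxx (mor1 (J _)) mulg1. Qed.

Let old_new k b c c' : k \in sys_links S -> link_edge k = link_edge k0 ->
  @link_point k b c = @link_point k0 b c' -> False.
Proof.
move=> kS ek [e1]; have [c2 ->] := attach_transport b ek c' => e2.
have := cons_size Sok b kS; rewrite e1 fst_k0_end -/N.
case: eqP => [eb _|_]; last by rewrite ltnn.
apply: unlinked; exists (link_point (~~ b) (c * c2^-1)), (link_weight k b).
exists k, b, (c * c2^-1); split=> //.
  by rewrite ek eb /k0; case: (a).
move: e1 e2; rewrite k0_end eb eqxx => e1 e2.
rewrite /link_point /shift e1; rewrite (gmulfM (s :=
  @attach Gamma GG (link_edge k, a.2))).
rewrite mulgA e2 (morV (@attach Gamma GG (link_edge k, a.2))) mulgK.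
by case: (y).
Qed.

Lemma add_link_consistent : consistent add_link.
Proof.
split=> [k b|k b|k|k k' b c c'].
- rewrite inE => /predU1P[->|kS]; last exact: ltnW (cons_size Sok b kS).
  by rewrite fst_k0_end; case: eqP => _ //; apply: ltnW.
- rewrite inE => /predU1P[->|kS] /=; last first.
    by rewrite ltn_eqF ?(cons_vertex Sok) // (cons_size Sok).
  rewrite fst_k0_end; case: (b =P a.2) => [->|nb];
    first by rewrite ltn_eqF // -ya /k0; case: (a).
  rewrite eqxx -src_rev; congr step_src; rewrite /rev_step /link_edge /=;
    congr (_, _).
  by move: nb; case: b; case: a.2.
- rewrite inE => /predU1P[->|kS]; last first.
    by rewrite !old_label ?(cons_size Sok) //; apply: (cons_label Sok).
  rewrite !k0_end mul1g /link_edge /=.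
  have ta : t a = if a.2 then (edge_elt GG T a.1)^-1 else edge_elt GG T a.1 by
    [].
  case ea: a.2 ta => ta /=; rewrite fresh_label old_label // ta //.
  by rewrite mulgVK.
rewrite !inE => /predU1P[ek|kS] /predU1P[ek'|kS'].
- by move=> _ _; rewrite ek ek'.
- by subst k => ee e; case: (@old_new k' b c' c).
- by subst k' => ee e; case: (@old_new k b c c').
exact: (cons_inj Sok).
Qed.

Lemma add_link_extends : extends S add_link.
Proof.
split=> /= [|k kS|k|i iN]; first exact: leqnSn.
- by rewrite inE kS orbT.
- by rewrite inE => /predU1P[->|]; [right|left].
by rewrite ltn_eqF.
Qed.

Lemma add_link_moves : moves add_link a y fresh 0%R.
Proof.
exists k0, a.2, 1; split; rewrite /= ?mem_head //.
- by rewrite /link_edge /k0 /=; case: (a).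
- rewrite /link_point k0_end eqxx /shift (mor1 (@attach Gamma GG _)) mulg1.
  by case: (y).
- by rewrite /link_point k0_end /shift (mor1 (@attach Gamma GG _)) mulg1;
    case: a.2.
by rewrite /link_weight; case: a.2.
Qed.
End NewLink.

Lemma extend_move S y a : consistent S -> (y.1 < sys_size S)%N ->
  step_src a = sys_vertex S y.1 ->
  exists S', [/\ consistent S', extends S S' &
    exists z w, moves S' a y z w /\ (z.1 < sys_size S')%N].
Proof.
move=> Sok ylt ya; have [[z [w m]]|nm] := pselect (exists z w, moves S a y z w).
  exists S; split=> //; first exact: extends_refl.
  exists z, w; split=> //; case: m => [k [b [c [kS _ _ -> _]]]].
  exact: (cons_size Sok).
exists (add_link S y a); split; first exact: add_link_consistent.
  exact: add_link_extends.
by exists (sys_size S, 1), 0%R; split=> //; apply: add_link_moves.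
Qed.

Lemma extend_run S y l v : consistent S -> (y.1 < sys_size S)%N ->
  composable (sys_vertex S y.1) l v ->
  exists S', [/\ consistent S', extends S S' & exists z w, runs S' y l z w].
Proof.
elim: l S y => [|[g a] l IHl] S y Sok ylt /=.
  by move=> _; exists S; split=> //; [exact: extends_refl | exists y, 0%R].
move=> [sa ga lc].
have [S1 [S1ok SS1 [z [w [m zlt]]]]] := extend_move (y := shift y g) Sok ylt sa.
have zv : sys_vertex S1 z.1 = step_tgt a.
  case: m => [k [b [c [kS -> _ -> _]]]].
  by rewrite /= (cons_vertex S1ok) // -src_rev.
rewrite -zv in lc.
have [S2 [S2ok SS2 [z' [w' r]]]] := IHl S1 z S1ok zlt lc.
exists S2; split=> //; first exact: extends_trans SS1 SS2.
exists z', (w + w')%R, z, w, w'; split=> //.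
exact: moves_extends SS2 m.
Qed.

Lemma extend_runs S (starts : seq (point * path_word GG)) : consistent S ->
  (forall s, s \in starts -> (s.1.1 < sys_size S)%N /\
     exists v, composable (sys_vertex S s.1.1) s.2 v) ->
  exists S' (res : seq (point * int)), [/\ consistent S', extends S S' &
    forall s, s \in starts -> exists2 zw,
      zw \in res & runs S' s.1 s.2 zw.1 zw.2].
Proof.
move=> Sok; elim: starts => [|s starts IHs] ok.
  by exists S, [::]; split=> //; exact: extends_refl.
have [|S1 [res [S1ok SS1 res1]]] := IHs.
  by move=> s' s's; apply: ok; rewrite inE s's orbT.
have [slt [v sv]] := ok s (mem_head _ _).
have [leN _ _ lab] := SS1; have [_ ev] := lab _ slt.
rewrite -ev in sv.
have [S2 [S2ok SS2 [z [w r]]]] := extend_run S1ok (leq_trans slt leN) sv.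
exists S2, ((z, w) :: res); split=> //; first exact: extends_trans SS1 SS2.
move=> s'; rewrite inE => /predU1P[->|/res1[zw zwr r']].
  by exists (z, w) => //; exact: mem_head.
exists zw; first by rewrite inE zwr orbT.
exact: runs_extends SS2 r'.
Qed.

End LinkSystems.

(** * The circle of a cyclically reduced path *)

Section Circle.
Variables (Gamma : graph) (GG : graph_of_groups Gamma) (T : subgraph Gamma).
Local Notation V := (vertex Gamma).
Local Notation P := (prodgroup (vertex_group GG)).
Local Notation G := (pi1 GG T).
Local Notation E := (path_val (vertex_elt T) (edge_elt GG T)).
Local Notation J := (@vertex_elt _ GG T).
Local Notation t := (step_val (edge_elt GG T)).
Local Notation attached a c := (@attach Gamma GG a c).

Variables (v : V) (s0 : P * step Gamma) (l0 : path_word GG).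
Let l : path_word GG := s0 :: l0.
Hypothesis lv : composable v l v.
Hypothesis lred : cyclically_reduced l.
Let n := size l.
Let nthl j := nth s0 l j.

(** The [j]-th syllable leads from the [j]-th copy to the next one, cyclically;
    the last step, which closes the circle, has weight 1 in the direction of
    the path. *)
Definition circle_link (j : nat) : link GG :=
  let s := nthl j in
  let here : point GG := (j, s.1) in
  let there : point GG := ((j.+1 %% n)%N, 1) in
  let w := if j.+1 == n then 1%R else 0%R in
  (s.2.1, if s.2.2 then there else here, if s.2.2 then here else there,
   if s.2.2 then (- w)%R else w).

Definition circle : system GG T := System n [seq circle_link j | j <- iota 0 n]
  (fun j => E (take j l)) (fun j => step_src (nthl j).2).

Let circle_end j b : link_end (circle_link j) b =
  if b == (nthl j).2.2 then (j, (nthl j).1) else ((j.+1 %% n)%N, 1).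
Proof. by rewrite /link_end /circle_link /=; case: b; case: (nthl j).2.2. Qed.

Let circle_weight j : link_weight (circle_link j) (nthl j).2.2 =
  if j.+1 == n then 1%R else 0%R.
Proof. by rewrite /link_weight /circle_link /=; case: (nthl j).2.2 => //;
  case: ifP. Qed.

Let circle_linkP k : k \in sys_links circle ->
  exists2 j, (j < n)%N & k = circle_link j.
Proof. by case/mapP=> j; rewrite mem_iota => /andP[_ jn] ->; exists j. Qed.

Let mem_circle j : (j < n)%N -> circle_link j \in sys_links circle.
Proof. by move=> jn; apply: map_f; rewrite mem_iota. Qed.

Let split_l j : (j < n)%N -> l = take j l ++ nthl j :: drop j.+1 l.
Proof. by move=> jn; rewrite -drop_nth // cat_take_drop. Qed.

Let next_vertex j : (j < n)%N ->
  step_tgt (nthl j).2 = step_src (nthl (j.+1 %% n)).2.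
Proof.
move=> jn; have := lv; rewrite (split_l jn) => /composable_catE[u _ [_ _ dv]].
have [jn'|jn'] := ltnP j.+1 n.
  by rewrite modn_small //; move: dv; rewrite (drop_nth s0 jn') => -[<-].
have ej : j.+1 = n by apply/eqP; rewrite eqn_leq jn.
rewrite ej modnn; move: dv; rewrite drop_oversize // => /= ->.
by have [<-] := lv.
Qed.

Let circle_step j : (j < n)%N ->
  point_label circle (j, (nthl j).1) * t (nthl j).2 =
  zpow (E l) (if j.+1 == n then 1%R else 0%R) *
    point_label circle ((j.+1 %% n)%N, 1).
Proof.
move=> jn; rewrite /point_label /=.
rewrite (mor1 (J (step_src (nthl (j.+1 %% n)).2))) mulg1.
have -> : E (take j l) * J (step_src (nthl j).2) (nthl j).1 * t (nthl j).2 =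
    E (take j.+1 l).
  by rewrite (take_nth s0 jn) -cats1 path_val_cat /= mulg1 mulgA.
have [ej|nj] := eqVneq j.+1 n.
  by rewrite ej modnn take_size take0 /= mulg1.
by rewrite modn_small ?mul1g // ltn_neqAle nj.
Qed.

(** Two links could overlap only at a copy that is entered and left by the same
    edge in opposite directions at points in the same orbit of the edge group,
    that is, where the path is not reduced. *)
Let no_backtrack i j b c c' : (i < n)%N -> (j < n)%N ->
  i = (j.+1 %% n)%N -> (nthl i).2 = ((nthl j).2.1, b) -> b = ~~ (nthl j).2.2 ->
  (nthl i).1 * attached (nthl i).2 c = attached (nthl i).2 c' -> False.
Proof.
move=> ilt jlt ei ea eb eg.
have [n1|n1] := eqVneq n 1%N.
  have i0 : i = 0%N by move: ilt; rewrite n1; case: (i).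
  have j0 : j = 0%N by move: jlt; rewrite n1; case: (j).
  by move: ea; rewrite eb i0 j0; case: (nthl 0).2 => e [].
have [m em] : exists m, rot j l = [:: nthl j, nthl i & m].
  rewrite /rot (drop_nth s0 jlt); have [jn'|jn'] := ltnP j.+1 n.
    by exists (drop j.+2 l ++ take j l);
      rewrite (drop_nth s0 jn') ei modn_small.
  have ej : j.+1 = n by apply/eqP; rewrite eqn_leq jlt.
  have j0 : (0 < j)%N by rewrite -ltnS ej; move: n1; rewrite /n /=; lia.
  rewrite drop_oversize // ei ej modnn -(prednK j0) /=.
  by exists (take j.-1 l0).
apply: (lred em (s1 := nthl j) (s2 := nthl i) _ (c := c' * c^-1)).
  by rewrite ea eb.
rewrite (gmulfM (s := @attach _ GG (nthl i).2)) (morV (@attach _ GG (nthl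
  i).2)).
apply: (canRL (mulgK _)); exact: eg.
Qed.

Lemma circle_consistent : consistent (E l) circle.
Proof.
split=> [k b|k b|k|k k' b c c'].
- case/circle_linkP=> j jn ->; rewrite circle_end; case: eqP => _ //=.
  by rewrite ltn_mod.
- case/circle_linkP=> j jn ->; rewrite circle_end.
  case: eqP => [->|nb]; first by rewrite /link_edge /=; case: (nthl j).2.
  transitivity (step_tgt (nthl j).2); first by rewrite next_vertex.
  rewrite -src_rev; congr step_src; rewrite /rev_step; congr (_, _).
  by move: nb; case: b; case: (nthl j).2.2.
- case/circle_linkP=> j jn ->; have := circle_step jn.
  rewrite !circle_end /= /link_edge /step_val /=; case: (nthl j).2.2 => //= e.
  rewrite zpowN; apply: (@mulgI _ (zpow (E l) (if j.+1 == n then 1%R else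
    0%R))).
  by rewrite mulVKg mulgA -e mulgVK.
case/circle_linkP=> i ilt ek; case/circle_linkP=> j jlt ek'; subst k k' => ee e.
suff : i = j by move=> ->.
have [] := e; rewrite !circle_end => e1 e2.
have attE j' b' (d : edge_group GG (link_edge (circle_link j'))) a :
    a = ((nthl j').2.1, b') -> exists d', attached (link_edge (circle_link j'),
      b') d = attached a d'.
  by move=> ->; exists d.
have split_step j' : (nthl j').2 = ((nthl j').2.1, (nthl j').2.2) by case:
  (nthl j').2.
move: e1 e2; case: eqP => bi; case: eqP => bj /=.
- by [].
- move=> ei e2; exfalso.
  have ai : (nthl i).2 = ((nthl j).2.1, b) by rewrite split_step -bi;
    congr (_, _).
  have [d ed] := attE i b c (nthl i).2 (etrans (split_step i) (congr1 (pair _)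
    (esym bi))).
  have [d' ed'] := attE j b c' (nthl i).2 ai.
  apply: (no_backtrack ilt jlt ei ai _ (c := d) (c' := d')).
    by move: bj; case: (b); case: (nthl j).2.2.
  by rewrite -ed -ed' e2 mul1g.
- move=> ej e2; exfalso.
  have aj : (nthl j).2 = ((nthl i).2.1, b) by rewrite split_step -bj;
    congr (_, _).
  have [d ed] := attE j b c' (nthl j).2 (etrans (split_step j) (congr1 (pair _)
    (esym bj))).
  have [d' ed'] := attE i b c (nthl j).2 aj.
  apply: (no_backtrack jlt ilt (esym ej) aj _ (c := d) (c' := d')).
    by move: bi; case: (b); case: (nthl i).2.2.
  by rewrite -ed -ed' -e2 mul1g.
move=> eij _; move/eqP: eij; rewrite -(addn1 i) -(addn1 j) eqn_modDr.
by rewrite !modn_small // => /eqP.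
Qed.

Lemma circle_run : runs circle (0%N, 1) l (0%N, 1) 1%R.
Proof.
have run j : (j < n)%N -> runs circle (j, 1) (drop j l) (0%N, 1) 1%R.
  have [m] := ubnP (n - j); elim: m => // m IHm in j *; rewrite ltnS => lem jn.
  rewrite (drop_nth s0 jn) /=.
  exists ((j.+1 %% n)%N, 1), (if j.+1 == n then 1%R else 0%R),
    (if j.+1 == n then 0%R else 1%R); split; last by case: ifP.
    exists (circle_link j), (nthl j).2.2, 1; split.
    - exact: mem_circle.
    - by rewrite /link_edge /=; case: (nthl j).2.
    - by rewrite /link_point circle_end eqxx /shift (mor1 (@attach _ GG _))
        mulg1 mul1g.
    - by rewrite /link_point circle_end /shift (mor1 (@attach _ GG _)) mulg1;
        case: (nthl j).2.2.
    by rewrite circle_weight.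
  have [ej|nj] := eqVneq j.+1 n.
    by rewrite ej modnn drop_oversize //; case: ej => ->.
  have jn' : (j.+1 < n)%N by rewrite ltn_neqAle nj.
  rewrite modn_small //; apply: IHm => //; lia.
by have := run 0%N isT; rewrite drop0.
Qed.
End Circle.

(** * Completing a partial action *)

Section RightMultiplication.
Variables (I : finType) (gT hT : finGroupType).
Variable f : {morphism [set: hT] >-> gT}.
Definition rmul_fun (y : I * gT) (k : hT) : I * gT := (y.1, y.2 * f k).
Lemma rmul_fun1 : rmul_fun^~ 1 =1 id.
Proof. by case=> i q; rewrite /rmul_fun morph1 mulg1. Qed.
Lemma rmul_funM y : act_morph rmul_fun y.
Proof. by move=> k l; rewrite /rmul_fun morphM ?inE // mulgA. Qed.
Definition rmul_act := TotalAction rmul_fun1 rmul_funM.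

(** The action is free, so the marks of all nontrivial subgroups vanish. *)
Lemma rmul_fix (H : {group hT}) :
  {in H &, injective f} ->
  #|'Fix_rmul_act(H)| = if H :==: 1 then #|{: I * gT}| else 0%N.
Proof.
move=> injf; case: eqP => [->|nH].
  by rewrite -cardsT; apply: eq_card => y; rewrite [RHS]inE;
    apply/afixP=> k /set1P->; rewrite act1.
apply/eqP; rewrite cards_eq0; apply/eqP/setP=> y.
rewrite [RHS]inE; apply/negbTE/negP=> /afixP fx.
apply: nH; apply/eqP; rewrite finset.eqEsubset sub1G andbT;
  apply/fintype.subsetP=> k kH.
have fk := congr1 snd (fx k kH).
apply/set1P; apply: injf; rewrite ?group1 // morph1.
by apply: (@mulgI _ y.2); rewrite mulg1; exact: fk.
Qed.
End RightMultiplication.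

Section Realization.
Variables (Gamma : graph) (GG : graph_of_groups Gamma) (T : subgraph Gamma).
Local Notation P := (prodgroup (vertex_group GG)).
Local Notation G := (pi1 GG T).
Local Notation attached a c := (@attach Gamma GG a c).

Variables (x : G) (S : system GG T).
Hypothesis Sok : consistent x S.
Variables (Q : finGroupType) (f : {multiplicative P -> Q}).
Hypothesis f_att : forall a, injective (f \o @attach _ GG a).
Hypothesis f_links : forall k k' b c c', k \in sys_links S ->
  k' \in sys_links S ->
  f (@link_point _ _ k b c).2 = f (@link_point _ _ k' b c').2 ->
  (@link_point _ _ k b c).2 = (@link_point _ _ k' b c').2.

Lemma link_point_inj (k : link GG) b : injective (@link_point _ GG k b).
Proof. by move=> c c' /(congr1 snd) /= /mulgI;
  apply: (@attach_inj _ GG (link_edge k, b)). Qed.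

Let X : finType := ('I_(sys_size S).+1 * Q)%type.

Definition realize (y : point GG) : X := (inord y.1, f y.2).

Lemma realize_link_inj k k' b c c' : k \in sys_links S -> k' \in sys_links S ->
  link_edge k = link_edge k' ->
  realize (@link_point _ _ k b c) = realize (@link_point _ _ k' b c') ->
  k = k' /\ @link_point _ _ k b c = @link_point _ _ k' b c'.
Proof.
move=> kS kS' ek [e1 /(f_links kS kS') e2].
have e : @link_point _ _ k b c = @link_point _ _ k' b c'.
  rewrite [LHS]surjective_pairing [RHS]surjective_pairing e2; congr (_, _).
  have := congr1 (@nat_of_ord _) e1; rewrite !inordK //= ltnS ltnW //;
    exact: (cons_size Sok).
by split=> //; apply: (cons_inj Sok) e.
Qed.

Lemma realize_mul k b (c d : edge_group GG (link_edge k)) :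
  realize (@link_point _ _ k b (c * d)) =
  ((realize (@link_point _ _ k b c)).1,
   (realize (@link_point _ _ k b c)).2 * f (attached (link_edge k, b) d)).
Proof.
rewrite /realize /link_point /shift /=; congr (_, _).
by rewrite (gmulfM (s := @attach _ GG (link_edge k, b))) mulgA (gmulfM (s :=
  f)).
Qed.

Let fstQ := @Morphism _ _ [set: Q * Q] fst (in2W (fun _ _ => erefl)).
Let sndQ := @Morphism _ _ [set: Q * Q] snd (in2W (fun _ _ => erefl)).
Let act1 := rmul_act 'I_(sys_size S).+1 fstQ.
Let act2 := rmul_act 'I_(sys_size S).+1 sndQ.

Definition realized_links (e : edge Gamma) : {set X * X} :=
  [set p | `[< exists k c, [/\ k \in sys_links S, link_edge k = e &
    p = (realize (@link_point _ _ k false c),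
      realize (@link_point _ _ k true c))] >]].

Lemma realized_linksP e p : p \in realized_links e <->
  exists k c, [/\ k \in sys_links S, link_edge k = e &
    p = (realize (@link_point _ _ k false c),
      realize (@link_point _ _ k true c))].
Proof. by rewrite /realized_links inE; split=> /asboolP. Qed.

Lemma realized_links_matching e :
  matching act1 act2 (edge_pairs_group f e) (realized_links e).
Proof.
split.
- move=> y z kk /edge_pairsP[d ->] /realized_linksP[k [c [kS ek [-> ->]]]].
  subst e; apply/realized_linksP; exists k, (c * d); split=> //.
  by rewrite !realize_mul.
- move=> y z z' /realized_linksP[k [c [kS ek e1]]].
  move=> /realized_linksP[k' [c' [kS' ek' e2]]].
  have ey : realize (link_point false c) = realize (link_point false c').
    exact: (etrans (esym (congr1 fst e1)) (congr1 fst e2)).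
  have [ekk ec] := realize_link_inj kS kS' (etrans ek (esym ek')) ey; subst k'.
  rewrite (congr1 snd e1 : z = _) (congr1 snd e2 : z' = _) /=.
  by rewrite (link_point_inj ec).
move=> y y' z /realized_linksP[k [c [kS ek e1]]].
move=> /realized_linksP[k' [c' [kS' ek' e2]]].
have ez : realize (link_point true c) = realize (link_point true c').
  exact: (etrans (esym (congr1 snd e1)) (congr1 snd e2)).
have [ekk ec] := realize_link_inj kS kS' (etrans ek (esym ek')) ez; subst k'.
rewrite (congr1 fst e1 : y = _) (congr1 fst e2 : y' = _) /=.
by rewrite (link_point_inj ec).
Qed.

(** Both actions of the edge group are free, hence have the same marks, and the
    partial injection given by the links extends. *)
Lemma edge_perm e : exists tau : {perm X},
  (forall k c, k \in sys_links S -> link_edge k = e ->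
     tau (realize (@link_point _ _ k false c)) =
       realize (@link_point _ _ k true c)) /\
  (forall i q (c : edge_group GG e),
     tau (i, q * f (attached (e, false) c)) =
       ((tau (i, q)).1, (tau (i, q)).2 * f (attached (e, true) c))).
Proof.
have marks (H : {group Q * Q}) : H \subset edge_pairs_group f e ->
    #|'Fix_act1(H)| = #|'Fix_act2(H)|.
  move=> /fintype.subsetP sH; rewrite !rmul_fix //.
    by move=> k l /sH kK /sH lK; apply: (edge_pairs_inj2 (@f_att (e, true))).
  by move=> k l /sH kK /sH lK; apply: (edge_pairs_inj1 (@f_att (e, false))).
have [tau [tauR tauA]] := equivariant_extension marks (realized_links_matching
  e).
exists tau; split=> [k c kS ek|i q c].
  by apply: tauR; apply/realized_linksP; exists k, c.
apply: (tauA (i, q) (f (attached (e, false) c), f (attached (e, true) c))).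
by apply/edge_pairsP; exists c.
Qed.
End Realization.

(** * The cyclic cover of the completed action *)

Section Deck.
Variables (Gamma : graph) (GG : graph_of_groups Gamma) (T : subgraph Gamma).
Local Notation P := (prodgroup (vertex_group GG)).
Local Notation attached a c := (@attach Gamma GG a c).

Variables (x : pi1 GG T) (S : system GG T).
Hypothesis Sok : consistent x S.
Variables (Q : finGroupType) (f : {multiplicative P -> Q}).
Hypothesis f_att : forall a, injective (f \o @attach _ GG a).
Hypothesis f_links : forall k k' b c c', k \in sys_links S ->
  k' \in sys_links S ->
  f (@link_point _ _ k b c).2 = f (@link_point _ _ k' b c').2 ->
  (@link_point _ _ k b c).2 = (@link_point _ _ k' b c').2.
Variables (Z : finGroupType) (a : Z).

Local Notation rz y := (realize S f y).

Let X : finType := ('I_(sys_size S).+1 * Q)%type.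
Let tau0 e : {perm X} := sval (cid (edge_perm Sok f_att f_links e)).

Let tau0_link k c : k \in sys_links S ->
  tau0 (link_edge k) (rz (@link_point _ _ k false c)) =
  rz (@link_point _ _ k true c).
Proof.
move=> kS.
by case: (svalP (cid (edge_perm Sok f_att f_links (link_edge k)))) => H _;
  apply: H.
Qed.

Let tau0_act e i q (c : edge_group GG e) :
  tau0 e (i, q * f (attached (e, false) c)) =
  ((tau0 e (i, q)).1, (tau0 e (i, q)).2 * f (attached (e, true) c)).
Proof.
by case: (svalP (cid (edge_perm Sok f_att f_links e))) => _ H; apply: H.
Qed.

Let on_link e (y : X) k := k \in sys_links S /\ link_edge k = e /\
  exists c, y = rz (@link_point _ _ k false c).

(** The added part of the completed edge bijections gets height 0, so that the
    sheet changes only at links of nonzero weight. *)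
Definition edge_height e (y : X) : int :=
  if pselect (exists k, on_link e y k) is left ex then (sval (cid ex)).2 else
    0%R.

Let edge_height_link k c : k \in sys_links S ->
  edge_height (link_edge k) (rz (@link_point _ _ k false c)) = k.2.
Proof.
move=> kS; rewrite /edge_height; case: pselect => [ex|[]]; last first.
  by exists k; split=> //; split=> //; exists c.
have [k'S [ek [c' ey]]] := svalP (cid ex).
have [ekk _] := realize_link_inj Sok f_links kS k'S (esym ek) ey.
exact: (congr1 snd (esym ekk)).
Qed.

Let edge_height_neq0 e y : edge_height e y <> 0%R ->
  exists k c, [/\ k \in sys_links S, link_edge k = e, k.2 <> 0%R &
    y = rz (@link_point _ _ k false c)].
Proof.
rewrite /edge_height; case: pselect => // ex w0.
by have [kS [ek [c ey]]] := svalP (cid ex); exists (sval (cid ex)), c.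
Qed.

Let edge_height_act e i q (c : edge_group GG e) :
  edge_height e (i, q * f (attached (e, false) c)) = edge_height e (i, q).
Proof.
have up (q' : Q) (d : edge_group GG e) k : on_link e (i, q') k ->
    on_link e (i, q' * f (attached (e, false) d)) k.
  move=> [kS [ek [c' ey]]]; split=> //; split=> //; subst e; exists (c' * d).
  by rewrite realize_mul -ey.
have [[k ky]|nk] := pselect (exists k, on_link e (i, q) k).
  have [kS [ek [c' ey]]] := ky; have [_ [_ [c2 ey2]]] := up q c k ky.
  by subst e; rewrite ey ey2 !edge_height_link.
rewrite /edge_height; case: pselect => [[k ky]|_]; last by case: pselect.
case: nk; exists k; have := up _ c^-1 k ky.
by rewrite -mulgA -gmulfM -(gmulfM (s :=
  @attach _ GG (e, false))) mulgV (mor1 (@attach _ GG _)) mor1 mulg1.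
Qed.

Let lift_edge e (yz : X * Z) : X * Z :=
  (tau0 e yz.1, yz.2 * zpow a (edge_height e yz.1)).

Let lift_edge_inj e : injective (lift_edge e).
Proof. by move=> [y z] [y' z'] [/perm_inj -> /mulIg ->]. Qed.

Definition deck_edge e : {perm X * Z} := perm (@lift_edge_inj e).

Let lift_mul (p : P) (yz : X * Z) : X * Z := ((yz.1.1, yz.1.2 * f p), yz.2).

Let lift_mul_inj p : injective (lift_mul p).
Proof. by move=> [[i q] z] [[i' q'] z'] [-> /mulIg -> ->]. Qed.

Definition deck_mul_fun p : {perm X * Z} := perm (@lift_mul_inj p).

Lemma deck_mulM : {morph deck_mul_fun : p q / p * q}.
Proof.
move=> p q; apply/permP=> -[[i g] z].
by rewrite permM !permE /lift_mul /= gmulfM mulgA.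
Qed.

Definition deck_mul : {multiplicative P -> {perm X * Z}} := as_mor deck_mulM.

Lemma deck_mulE p i q z : deck_mul p ((i, q), z) = ((i, q * f p), z).
Proof. exact: permE. Qed.

Lemma deck_edgeE e y z :
  deck_edge e (y, z) = (tau0 e y, z * zpow a (edge_height e y)).
Proof. exact: permE. Qed.

Let shift_deck (yz : X * Z) : X * Z := (yz.1, a * yz.2).
Let shift_deck_inj : injective shift_deck.
Proof. by move=> [y z] [y' z'] [-> /mulgI ->]. Qed.
Definition deck : {perm X * Z} := perm shift_deck_inj.

Lemma deckE y z : deck (y, z) = (y, a * z).
Proof. exact: permE. Qed.

Lemma deck_mul_cent p : deck_mul p \in 'C[deck]%G.
Proof.
by apply/cent1P/permP=> -[[i q] z]; rewrite !permM !(deckE, deck_mulE).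
Qed.

Lemma deck_edge_cent e : deck_edge e \in 'C[deck]%G.
Proof.
by apply/cent1P/permP=> -[y z]; rewrite !permM !(deckE, deck_edgeE) mulgA.
Qed.

Lemma deck_compat e (c : edge_group GG e) :
  deck_mul (attached (e, false) c) * deck_edge e =
    deck_edge e * deck_mul (attached (e, true) c).
Proof.
apply/permP=> -[[i q] z]; rewrite !permM deck_mulE !deck_edgeE tau0_act
  edge_height_act.
by case: (tau0 e (i, q)) => j q'; rewrite deck_mulE.
Qed.

Local Notation val := (path_val (fun=> deck_mul) deck_edge).

Lemma deck_moves st y z w u : moves S st y z w ->
  step_val deck_edge st (rz y, u) = (rz z, u * zpow a w).
Proof.
move=> [k [b [c [kS -> -> -> ->]]]].
have up u' : deck_edge (link_edge k) (rz (@link_point _ _ k false c), u') =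
    (rz (@link_point _ _ k true c), u' * zpow a k.2).
  by rewrite deck_edgeE tau0_link // edge_height_link.
case: b; rewrite /step_val /=; last exact: up.
apply: (@perm_inj _ (deck_edge (link_edge k))); rewrite permKV up.
by rewrite /link_weight zpowN mulgVK.
Qed.

Lemma deck_mul_realize y u g : deck_mul g (rz y, u) = (rz (shift y g), u).
Proof. by rewrite deck_mulE /shift /= /realize /= gmulfM. Qed.

Lemma deck_runs y l z w u : runs S y l z w ->
  val l (rz y, u) = (rz z, u * zpow a w).
Proof.
elim: l y w u => [|[g st] l IHl] y w u /=.
  by move=> [<- ->]; rewrite perm1 mulg1.
move=> [y' [w1 [w2 [mv ru ->]]]].
rewrite !permM deck_mul_realize (deck_moves _ mv) (IHl _ _ _ ru).
by rewrite zpowD mulgA.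
Qed.

(** The sheet changes only where the height is nonzero, and the step there leads
    from one end of a link of nonzero weight to the other. *)
Lemma deck_crossing l y u y' u' : val l (y, u) = (y', u') -> u <> u' ->
  exists l1 g k b (c : edge_group GG (link_edge k)) l2 u1,
    [/\ l = l1 ++ (g, (link_edge k, b)) :: l2, k \in sys_links S, k.2 <> 0%R &
      (val l1 * deck_mul g) (y, u) = (rz (@link_point _ _ k b c), u1)].
Proof.
elim: l y u => [|[g st] l IHl] y u /=; first by rewrite perm1 => -[_ ->].
rewrite !permM; case: y => i q; rewrite deck_mulE.
case est : (step_val deck_edge st _) => [y2 u2] ev uu'.
have [eu|nu] := eqVneq u u2.
  subst u2; have [l1 [g' [k [b [c [l2 [u1 [-> kS k0 e1]]]]]]]] :=
    IHl _ _ ev uu'.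
  exists ((g, st) :: l1), g', k, b, c, l2, u1; split=> //=.
  by rewrite -!mulgA 2!permM deck_mulE est.
exists [::], g; case: st est => e [] est.
  have e2 : deck_edge e (y2, u2) = (i, q * f g, u) by rewrite -est permKV.
  rewrite deck_edgeE in e2; case: e2 => e2 e3.
  have [k [c [kS ek k0 ey2]]] : exists k c, [/\ k \in sys_links S,
      link_edge k = e, k.2 <> 0%R & y2 = rz (@link_point _ _ k false c)].
    by apply: edge_height_neq0 => w0; move/eqP: nu; apply; rewrite -e3 w0 mulg1.
  exists k, true, c, l, u; subst e; split=> //=.
  by rewrite mul1g deck_mulE -e2 ey2 tau0_link.
move: est; rewrite /step_val /= deck_edgeE => -[_ e3].
have [k [c [kS ek k0 ey2]]] : exists k c, [/\ k \in sys_links S,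
    link_edge k = e, k.2 <> 0%R &
    (i, q * f g) = rz (@link_point _ _ k false c)].
  by apply: edge_height_neq0 => w0; move/eqP: nu; apply; rewrite -e3 w0 mulg1.
exists k, false, c, l, u; subst e; split=> //=.
by rewrite mul1g deck_mulE ey2.
Qed.
End Deck.

(** * Elements that are not conjugate into a vertex group *)

Section Hyperbolic.
Variables (Gamma : graph) (GG : graph_of_groups Gamma) (T : subgraph Gamma).
Local Notation P := (prodgroup (vertex_group GG)).
Local Notation G := (pi1 GG T).
Local Notation E := (path_val (vertex_elt T) (edge_elt GG T)).
Local Notation J := (@vertex_elt _ GG T).
Local Notation attached a c := (@attach Gamma GG a c).

Lemma runs_bound (x : G) (S : system GG T) y l z w : consistent x S ->
  (y.1 < sys_size S)%N -> runs S y l z w -> (z.1 < sys_size S)%N.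
Proof.
move=> Sok; elim: l y w => [|s l IHl] y w ylt /=; first by case=> <-.
move=> [y' [w1 [w2 [[k [b [c [kS _ _ -> _]]]] ru _]]]].
by apply: IHl ru; apply: (cons_size Sok).
Qed.

Lemma rotation_conj l1 g a l2 :
  conjugate_elts (E (l1 ++ (g, a) :: l2))
    (E ((1, a) :: l2 ++ l1) * J (step_src a) g).
Proof.
exists (E l1 * J (step_src a) g).
rewrite /= (mor1 (J _)) mul1g !path_val_cat /= conjgE invgM !mulgA mulgVK.
by rewrite mulVg mul1g.
Qed.

Lemma runs_conj (x : G) (S : system GG T) y l g z :
  consistent x S -> composable (sys_vertex S y.1) l (sys_vertex S y.1) ->
  runs S y l z 1%R -> y = shift z g ->
  conjugate_elts x (E l * J (sys_vertex S y.1) g).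
Proof.
move=> Sok lc ru yz; have [e vz] := runs_label Sok lc ru.
exists (point_label S y); rewrite conjgE; apply: (canLR (mulKg _)).
rewrite (mulgA (point_label S y)) e /= expg1 -(mulgA x); congr (_ * _).
rewrite -vz {1}yz /point_label /= (gmulfM (s := @vertex_elt _ GG T _)).
exact: mulgA.
Qed.

Hypothesis edges_finite : finite_set [set: edge Gamma]%classic.
Hypothesis edge_groups_finite :
  forall e : edge Gamma, finite_set [set: edge_group GG e]%classic.
Hypothesis Tconn : forall v w, exists p, walk v p w /\ walk_in T p.
Hypothesis Tnc : forall p, walk_in T p -> ~ circuit p.
Hypothesis csP : conjugacy_separable P.

(** Either [y] is elliptic, and then it moves no point to another sheet, while
    [x] moves the base point of the circle one sheet further; or the path of
    [y] from the conjugate of the base point crosses the circle, and the part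
    of the partial action reached from there carries labels. *)
Lemma hyperbolic_separation x y v l w m q :
  composable v l v -> l <> [::] -> cyclically_reduced l ->
    conjugate_elts x (E l) ->
  composable w m w -> supported w q -> m = [::] \/ q = 1 ->
  conjugate_elts y (E m * J w q) ->
  ~ conjugate_elts x y -> finitely_separated x y.
Proof.
move=> lc ln lred xl mc qw mq ym nxy.
case: l lc ln lred xl => // s0 l0 lc _ lred xl.
set l := s0 :: l0 in lc lred xl.
pose S0 := circle T s0 l0.
have S0ok : consistent (E l) S0 := @circle_consistent _ GG T v s0 l0 lc lred.
have [atts attsP] :=
  enum_steps edges_finite edge_groups_finite (fun a c => attached a c).
(* The rotations of [m], to be followed from the links of the circle. *)
pose rotated (kb : link GG * bool) (pi : P * nat) : point GG * path_word GG :=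
  (shift (link_end kb.1 kb.2) pi.1,
   (1, (link_edge kb.1, kb.2)) :: drop pi.2.+1 m ++ take pi.2 m).
pose valid (s : point GG * path_word GG) := (s.1.1 < sys_size S0)%N /\
  exists v', composable (sys_vertex S0 s.1.1) s.2 v'.
pose starts := [seq s <- [seq rotated kb pi |
    kb <- [seq (k, b) | k <- sys_links S0, b <- [:: true; false]],
    pi <- [seq (p, i) | p <- atts, i <- iota 0 (size m)]] | `[< valid s >]].
have [|S [res [Sok S0S resP]]] := @extend_runs _ _ _ _ S0 starts S0ok.
  by move=> s; rewrite mem_filter => /andP[/asboolP].
have [leS subS wtS labS] := S0S.
have rotP k b (c : edge_group GG (link_edge k)) m1 g m2 :
    k \in sys_links S -> k.2 <> 0%R -> m = m1 ++ (g, (link_edge k, b)) :: m2 ->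
    let l' := (1, (link_edge k, b)) :: m2 ++ m1 in
    composable (sys_vertex S (@link_point _ _ k b c).1) l'
      (sys_vertex S (@link_point _ _ k b c).1) /\
    exists2 zw, zw \in res & runs S (@link_point _ _ k b c) l' zw.1 zw.2.
  move=> kS k0 em l'; have {}k0 : k \in sys_links S0 by case: (wtS k kS).
  have vS : sys_vertex S (@link_point _ _ k b c).1 = step_src (link_edge k, b).
    by rewrite (cons_vertex Sok).
  have lc' : composable (step_src (link_edge k, b)) l'
      (step_src (link_edge k, b)).
    move: mc; rewrite em => /composable_catE[v' m1c [ev' _ m2c]].
    subst v'.
    split=> //; first exact: supported1.
    exact: composable_cat m2c m1c.
  split; first by rewrite vS.
  apply: (resP (@link_point _ _ k b c, l')).
  rewrite mem_filter; apply/andP; split.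
    apply/asboolP; split=> /=; first exact: (cons_size S0ok).
    exists (step_src (link_edge k, b)).
    have := cons_vertex S0ok b k0; rewrite /= => ->; exact: lc'.
  apply/allpairsP; exists ((k, b), (attached (link_edge k, b) c, size m1));
    split.
  - by apply/allpairsP; exists (k, b); split=> //; case: (b); rewrite !inE.
  - apply/allpairsP; exists (attached (link_edge k, b) c, size m1); split=> //;
      first exact: attsP.
    by rewrite mem_iota em size_cat /= addnS ltnS leq_addr.
  rewrite /rotated /= em -cat_rcons drop_size_cat ?size_rcons //.
  by rewrite -cats1 -catA take_size_cat.
pose pts := [seq (link_end kb.1 kb.2).2 * p |
    kb <- [seq (k, b) | k <- sys_links S, b <- [:: true; false]], p <- atts] ++
  atts ++ [seq zw.1.2 * s.1 | zw <- res, s <- m].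
have [Q [f finj]] := separate_elements pts csP.
have lp_pts k b c : k \in sys_links S -> (@link_point _ GG k b c).2 \in pts.
  move=> kS; rewrite !mem_cat; apply/orP; left.
  apply/allpairsP; exists ((k, b), attached (link_edge k, b) c); split=> //;
    last exact: attsP.
  by apply/allpairsP; exists (k, b); split=> //; case: (b); rewrite !inE.
have f_att a : injective (f \o @attach _ GG a).
  have ap c : attached a c \in pts by rewrite !mem_cat attsP orbT.
  by move=> c d /(finj _ _ (ap c) (ap d)); apply: attach_inj.
have f_links k k' b c c' : k \in sys_links S -> k' \in sys_links S ->
    f (@link_point _ GG k b c).2 = f (@link_point _ GG k' b c').2 ->
    (@link_point _ GG k b c).2 = (@link_point _ GG k' b c').2.
  by move=> kS k'S; apply: finj; apply: lp_pts.
(* The cyclic group is so large that among the weights of the finitely many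
   paths only 1 itself is congruent to 1. *)
pose N := (\sum_(zw <- res) `|zw.2 - 1|)%N.
pose Z : finGroupType := 'I_(N.+2).
have [a [aC aN]] : exists a : Z,
    (forall u : Z, a * u = u * a) /\ (N.+1 < #[a])%N.
  by exists Zp1; split; [exact: Zp_mulgC | rewrite order_Zp1].
move: Z a aC aN => Z a aC aN.
have small zw : zw \in res -> zpow a zw.2 = a -> zw.2 = 1%R.
  move=> zwr /zpow_eq_gen; apply; apply: leq_ltn_trans (ltnW aN).
  by rewrite /N (big_rem zw) //= leq_addr.
pose phi := deck_mul S f Z.
pose tau := deck_edge Sok f_att f_links a.
apply: (@separation_criterion _ GG T Tconn Tnc _ phi tau 'C[deck S Q a]%G
  x y v l 1 w m q) => //.
- by move=> e c; apply: deck_compat.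
- by move=> p; apply: deck_mul_cent.
- by move=> e; apply: deck_edge_cent.
- exact: supported1.
- by rewrite (mor1 (J v)) mulg1.
move=> g /cent1P gd; rewrite (mor1 phi) mulg1 => exy.
have run0 : runs S (0%N, 1) l (0%N, 1) 1%R.
  by apply: runs_extends S0S _; apply: circle_run.
have ex := deck_runs Sok f_att f_links a (1 : Z) run0.
rewrite /= expg1 mul1g in ex.
case ep : (g (realize S f (0%N, 1), 1)) => [p0 u0].
have dg yz : g (deck S Q a yz) = deck S Q a (g yz) by rewrite -!permM gd.
have em : (path_val (fun=> phi) tau m * phi q) (p0, u0) = (p0, a * u0).
  rewrite -exy -ep permJ ex.
  have -> : (realize S f (0%N, 1), a) = deck S Q a (realize S f (0%N, 1), 1).
    by rewrite deckE mulg1.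
  by rewrite dg ep deckE.
have an1 : a <> 1 by move=> a1; move: aN; rewrite a1 order1.
have u0a : u0 <> a * u0.
  by move=> e; apply: an1; apply: (@mulIg _ u0); rewrite mul1g -e.
case: mq => [m0|q1].
  move: em; rewrite m0 /= mul1g; case: (p0) => i0 q0;
    rewrite deck_mulE => -[_ e].
  by move/u0a: e.
move: em; rewrite q1 (mor1 phi) mulg1 => em.
have [m1 [g1 [k [b [c [m2 [u1 [em12 kS k0 ec]]]]]]]] := deck_crossing em u0a.
have [lc' [zw zwr ru]] := rotP k b c m1 g1 m2 kS k0 em12.
have er := deck_runs Sok f_att f_links a u1 ru.
set y0 := link_point b c in ec lc' ru er.
set l' := (1, _) :: _ in lc' ru er.
(* The rotated word, read from the crossing, also returns to its starting
   point one sheet further. *)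
pose M := path_val (fun=> phi) tau m1 * phi g1.
pose R := step_val tau (link_edge k, b) * path_val (fun=> phi) tau m2.
have cM : M \in 'C[deck S Q a]%G.
  rewrite groupM ?deck_mul_cent //; elim: (m1) => [|s r IHr];
    first exact: group1.
  rewrite /= !groupM ?deck_mul_cent //.
  by rewrite /step_val; case: s.2.2; rewrite ?groupV deck_edge_cent.
have dM yz : M (deck S Q a yz) = deck S Q a (M yz).
  by rewrite -!permM (cent1P cM).
have MR : R (M (p0, u0)) = deck S Q a (p0, u0).
  have -> : deck S Q a (p0, u0) = path_val (fun=> phi) tau m (p0, u0).
    by rewrite em deckE.
  by rewrite em12 path_val_cat /= -permM /M /R !mulgA.
have RM : path_val (fun=> phi) tau l' * phi g1 = R * M.
  by rewrite /= (mor1 phi) mul1g path_val_cat /R /M !mulgA.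
have turn : (path_val (fun=> phi) tau l' * phi g1) (realize S f y0, u1) =
    deck S Q a (realize S f y0, u1).
  have ecM : M (p0, u0) = (realize S f y0, u1) by exact: ec.
  by rewrite RM permM -ecM MR dM.
move: turn; rewrite permM er deck_mul_realize deckE => turn.
have y0S : (y0.1 < sys_size S)%N by apply: (cons_size Sok).
have e1 := congr1 (fun yz => nat_of_ord yz.1.1) turn.
have e2 := congr1 (fun yz => yz.1.2) turn.
have e3 := congr1 (fun yz => yz.2) turn.
have {}e1 : zw.1.1 = y0.1.
  by move: e1; rewrite /= !inordK // ltnS ltnW // (runs_bound Sok _ ru).
have {}e2 : zw.1.2 * g1 = y0.2.
  apply: finj e2; last exact: lp_pts.
  rewrite !mem_cat; apply/orP; right; apply/orP; right.
  apply/allpairsP; exists (zw, (g1, (link_edge k, b))); split=> //.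
  by rewrite em12 mem_cat mem_head orbT.
have {}e3 : zw.2 = 1%R.
  by apply: small => //; apply: (@mulgI _ u1); rewrite -aC; exact: e3.
rewrite e3 in ru.
have y0E : y0 = shift zw.1 g1 by rewrite /shift e1 e2; case: (y0).
have conj_x := runs_conj Sok lc' ru y0E.
rewrite (cons_vertex Sok b kS : sys_vertex S y0.1 = _) in conj_x.
apply: nxy; apply: conjugate_elts_trans xl _;
  apply: conjugate_elts_trans conj_x _.
apply: conjugate_elts_sym; apply: conjugate_elts_trans ym _.
have -> : E m * J w q = E m by rewrite q1 (mor1 (J w)) mulg1.
by rewrite em12; apply: rotation_conj.
Qed.
End Hyperbolic.

(** * Conjugacy separability of the fundamental group *)

Local Open Scope classical_set_scope.

Theorem theorem1p1 (Gamma : graph) (GG : graph_of_groups Gamma)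
    (T : subgraph Gamma) :
  finite_graph Gamma ->
  connected_graph Gamma ->
  (forall v : vertex Gamma, conjugacy_separable (vertex_group GG v)) ->
  (forall e : edge Gamma, finite_set [set: edge_group GG e]) ->
  maximal_subtree T ->
  conjugacy_separable (pi1 GG T).
Proof.
move=> [_ finE] conn csV finEG maxT; have [[Tc Tnc] _] := maxT.
have span := maximal_subtree_spanning conn maxT.
have Tconn v w : exists p, walk v p w /\ walk_in T p by apply: Tc.
have csP := prodgroup_conjugacy_separable csV.
apply: conjugacy_separableP => x y nxy.
(* Without a vertex there are no generators, and the group is trivial. *)
have [[r _]|V0] := pselect (exists r : vertex Gamma, True); last first.
  have triv z : z = 1 :> pi1 GG T.
    elim/presented_ind: z => [//|z z' -> ->|[[[v g]|e] b]];
      first by rewrite mulg1.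
      by case: V0; exists v.
    by case: V0; exists (d0 e).
  by case: nxy; rewrite (triv x) (triv y); apply: conjugate_elts_refl.
have hyp := hyperbolic_separation finE finEG Tconn Tnc csP.
have [[v [p [pv xp]]]|[v [l [lc ln lred xl]]]] := cyclic_normal_form Tconn r x;
have [[w [q [qw yq]]]|[w [m [mc mn mred ym]]]] := cyclic_normal_form Tconn r y.
- exact: (elliptic_separation finE finEG Tconn Tnc csP pv xp qw yq nxy).
- apply: finitely_separated_sym.
  apply: (hyp y x w m v [::] p mc mn mred ym (erefl v) pv (or_introl erefl)).
    by rewrite /= mul1g.
  by move/conjugate_elts_sym.
- apply: (hyp x y v l w [::] q lc ln lred xl (erefl w) qw (or_introl erefl)) =>
    //.
  by rewrite /= mul1g.
apply: (hyp x y v l w m 1 lc ln lred xl mc (supported1 GG w) (or_intror erefl))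
  => //.
by rewrite (mor1 (@vertex_elt _ GG T w)) mulg1.
Qed.
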